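(* For every integer $k\ge1$, $$\tilde H_{2k+2}=\frac{2(k+1)}{4^k\tilde\omega^{2k+2}}\,[1+(-1)^{k+1}]\int_0^\infty e^{-t}f_1(i,t)\,t^{2k+1}\,dt,$$ where $e^{-t}f_1(i,t)=\dfrac{1+\cos t}{4(\cosh t-\cos t)}$. Equivalently, for $k\ge1$, $\tilde H_{4k}=\dfrac{8k}{4^{2k-1}\tilde\omega^{4k}}\displaystyle\int_0^\infty e^{-t}f_1(i,t)t^{4k-1}dt$ and $\tilde H_{4k+2}=0$.
   Context: Let $\tilde\omega=2\int_0^1\frac{dx}{\sqrt{1-x^4}}=\frac{\sqrt\pi}{2}\frac{\Gamma(1/4)}{\Gamma(3/4)}$, and let $\wp$ be the Weierstrass elliptic function with period lattice $\tilde\omega\mathbb Z+\tilde\omega i\mathbb Z$ (so $\wp'^2=4\wp^3-4\wp$). The Hurwitz numbers $\tilde H_n$ ($n\ge2$) are defined by the Laurent expansion $\wp(z)=\frac1{z^2}+\sum_{n\ge2}\frac{2^n\tilde H_n}{n}\frac{z^{n-2}}{(n-2)!}$ about $z=0$. Here $f_1(i,t)=\dfrac{\cos^2(t/2)}{1-2e^{-t}\cos t+e^{-2t}}$. *)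

(* Defs.v *)
From Stdlib Require Import Reals Lra Lia ZArith List.
Import ListNotations.
Open Scope R_scope.

Definition C : Type := (R * R)%type.
Definition Cre (z : C) : R := fst z.
Definition Cim (z : C) : R := snd z.
Definition C0 : C := (0, 0).
Definition Cadd (z w : C) : C := (Cre z + Cre w, Cim z + Cim w).
Definition Copp (z : C) : C := (- Cre z, - Cim z).
Definition Csub (z w : C) : C := Cadd z (Copp w).
Definition Cmul (z w : C) : C :=
  (Cre z * Cre w - Cim z * Cim w, Cre z * Cim w + Cim z * Cre w).
Definition Cinv (z : C) : C :=
  let d := Cre z * Cre z + Cim z * Cim z in (Cre z / d, - Cim z / d).
Definition CofR (x : R) : C := (x, 0).
Fixpoint Cpow (z : C) (n : nat) : C :=
  match n with O => (1, 0) | S m => Cmul z (Cpow z m) end.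
Definition Cnorm (z : C) : R := sqrt (Cre z * Cre z + Cim z * Cim z).

Definition Cseq_cv (u : nat -> C) (l : C) : Prop :=
  forall eps : R, eps > 0 -> exists N0 : nat, forall N : nat, (N >= N0)%nat ->
    Cnorm (Csub (u N) l) < eps.

Definition is_omega_tilde (w : R) : Prop :=
  (forall b : R, 0 <= b < 1 ->
     inhabited (Riemann_integrable (fun x => / sqrt (1 - x ^ 4)) 0 b)) /\
  (forall eps : R, eps > 0 -> exists delta : R, delta > 0 /\
     forall (b : R) (pr : Riemann_integrable (fun x => / sqrt (1 - x ^ 4)) 0 b),
       1 - delta < b < 1 -> Rabs (2 * RiemannInt pr - w) < eps).

Definition lattice_pt (w : R) (m n : Z) : C := (w * IZR m, w * IZR n).

Definition zrange (N : nat) : list Z :=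
  map (fun j => (Z.of_nat j - Z.of_nat N)%Z) (seq 0 (2 * N + 1)).

Definition Csum_list (l : list C) : C := fold_right Cadd C0 l.

Definition wp_partial (w : R) (z : C) (N : nat) : C :=
  Cadd (Cinv (Cmul z z))
    (Csum_list
       (flat_map (fun m : Z =>
          map (fun n : Z =>
                 if (Z.eqb m 0 && Z.eqb n 0)%bool then C0
                 else let lam := lattice_pt w m n in
                      Csub (Cinv (Cmul (Csub z lam) (Csub z lam)))
                           (Cinv (Cmul lam lam)))
              (zrange N))
          (zrange N))).

(* wp(z) = 1/z^2 + sum' (1/(z-lam)^2 - 1/lam^2)  (absolutely convergent,
   so computed as the limit of square partial sums) *)
Definition wp_value (w : R) (z : C) (v : C) : Prop :=
  Cseq_cv (wp_partial w z) v.

(* wp(z) = 1/z^2 + sum_{n>=2} (2^n H_n / n) z^(n-2)/(n-2)!  for 0 < |z| < r *)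
Definition laurent_coef (H : nat -> R) (n : nat) : R :=
  2 ^ n * H n / INR n / INR (fact (n - 2)).

Definition laurent_partial (H : nat -> R) (z : C) (N : nat) : C :=
  Csum_list (map (fun j => Cmul (CofR (laurent_coef H (j + 2))) (Cpow z j))
                 (seq 0 (S N))).

Definition is_hurwitz_seq (w : R) (H : nat -> R) : Prop :=
  exists r : R, r > 0 /\
    forall z : C, 0 < Cnorm z < r ->
      exists v : C, wp_value w z v /\
        Cseq_cv (laurent_partial H z) (Csub v (Cinv (Cmul z z))).

Definition f1_i (t : R) : R :=
  (cos (t / 2)) ^ 2 / (1 - 2 * exp (- t) * cos t + exp (- 2 * t)).

Definition improper_int_0_inf (f : R -> R) (l : R) : Prop :=
  (forall b : R, 0 <= b -> inhabited (Riemann_integrable f 0 b)) /\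
  (forall eps : R, eps > 0 -> exists M : R,
     forall (b : R) (pr : Riemann_integrable f 0 b), b > M ->
       Rabs (RiemannInt pr - l) < eps).

(* Main.v *)
(** Write mu = m + n i.  Multiplication by i splits the nonzero Gaussian integers into
    four copies of the sector |n| <= m, m >= 1, points on the two boundary rays having
    weight 1/2.  With that weight, sum_(|n| <= m) cos (n t) = sin (m t) cot (t / 2), and
    summing the geometric series in exp (- t (1 - i)) gives
      sum_(m >= 1) exp (- m t) sin (m t) cot (t / 2) = 2 exp (- t) f_1(i, t).
    As int_0^oo t^p exp (- mu t) dt = p! / mu^(p + 1), integrating against t^(2k+1) turns
    the integral into the sector part of the Eisenstein sum of mu^-(2k+2) over the
    Gaussian integers.  The rotation by i multiplies this sum by (-1)^(k+1), so it is
    four times its sector part when k is odd and vanishes when k is even.  Finally the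
    Eisenstein sums are the Laurent coefficients of the Weierstrass function, which is
    read off on the positive real axis from a Taylor expansion of
    1 / (x - lambda)^2 - 1 / lambda^2 with remainder uniform in the square truncation. *)

From Coquelicot Require Import Coquelicot.
From Stdlib Require Import Reals Lra Lia ZArith List.
Require Import Defs.
Open Scope R_scope.

(** * The integrand as a sum over a quarter of the lattice *)

(* For even [phi], the sum over [|n| <= m] in which the two terms [n = m], [n = - m]
   have weight 1/2. *)
Fixpoint half_sum (phi : nat -> R) (m : nat) : R :=
  match m with O => 0 | S p => half_sum phi p + phi p + phi (S p) end.

(* Equals [sin (m t) cot (t / 2)] where [sin (t / 2) <> 0]. *)
Definition kernel (t : R) (m : nat) : R :=
  half_sum (fun n => cos (INR n * t)) m.

(** By 2 cos t cos x = cos (x + t) + cos (x - t) the values cos (n t) satisfy a second order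
    recurrence, which the weighted partial sums inherit. *)
Lemma kernel_rec t p :
  kernel t (S (S p)) = 2 * cos t * kernel t (S p) - kernel t p.
Proof.
  assert (Hc : forall x : R, cos (x + t) = 2 * cos t * cos x - cos (x - t)).
  { intros x; rewrite cos_plus, cos_minus; ring. }
  assert (H2 : forall n, cos (INR (S (S n)) * t)
    = 2 * cos t * cos (INR (S n) * t) - cos (INR n * t)).
  { intros n. replace (INR (S (S n)) * t) with (INR (S n) * t + t)
      by (rewrite !S_INR; ring).
    rewrite Hc. do 2 f_equal. rewrite S_INR; ring. }
  unfold kernel. induction p as [|p IH].
  - cbn [half_sum]. rewrite H2. simpl INR. rewrite Rmult_0_l, Rmult_1_l, cos_0. ring.
  - change (half_sum (fun n => cos (INR n * t)) (S (S p))
      + cos (INR (S (S p)) * t) + cos (INR (S (S (S p))) * t)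
      = 2 * cos t * (half_sum (fun n => cos (INR n * t)) (S p)
                     + cos (INR (S p) * t) + cos (INR (S (S p)) * t))
        - (half_sum (fun n => cos (INR n * t)) p
           + cos (INR p * t) + cos (INR (S p) * t))).
    rewrite IH, (H2 (S p)), (H2 p). ring.
Qed.

Lemma half_sum_abs_le (phi : nat -> R) (B : R) m :
  (forall n, Rabs (phi n) <= B) -> Rabs (half_sum phi m) <= 2 * INR m * B.
Proof.
  intros HB; induction m as [|m IH]; cbn [half_sum].
  - rewrite Rabs_R0; simpl; lra.
  - rewrite S_INR.
    pose proof (Rabs_triang (half_sum phi m + phi m) (phi (S m))).
    pose proof (Rabs_triang (half_sum phi m) (phi m)).
    pose proof (HB m); pose proof (HB (S m)). lra.
Qed.

Lemma kernel_abs_le t m : Rabs (kernel t m) <= 2 * INR m.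
Proof.
  rewrite <- (Rmult_1_r (2 * INR m)). apply half_sum_abs_le.
  intros n; apply Rabs_le, COS_bound.
Qed.

(** The factor on the left is the characteristic polynomial of [kernel_rec], so the product
    telescopes to its two ends. For q = exp (- t) it is [denom t], and q (1 + cos t) is the term
    that produces the integrand. *)
Lemma kernel_gen_sum q t N :
  (1 - 2 * q * cos t + q ^ 2) * sum_f_R0 (fun m => q ^ m * kernel t m) N
  = q * (1 + cos t) - q ^ (S N) * kernel t (S N) + q ^ (S (S N)) * kernel t N.
Proof.
  induction N as [|N IH].
  - unfold kernel; simpl. rewrite (Rmult_0_l t), (Rmult_1_l t), cos_0; ring.
  - rewrite tech5, Rmult_plus_distr_l, IH, kernel_rec. cbv beta.
    generalize (kernel t N) (kernel t (S N)). intros a b. simpl; ring.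
Qed.

Lemma exp_minus_exp_opp_abs x : Rabs x <= Rabs (exp x - exp (- x)).
Proof.
  assert (H : forall y, 0 <= y -> y <= exp y - exp (- y)).
  { intros y Hy. pose proof (exp_ineq1_le y).
    assert (exp (- y) <= 1).
    { rewrite <- exp_0. destruct Hy as [Hy|<-].
      - apply Rlt_le, exp_increasing; lra.
      - rewrite Ropp_0; lra. }
    lra. }
  destruct (Rle_dec 0 x) as [Hx|Hx].
  - specialize (H x Hx). rewrite !Rabs_pos_eq; lra.
  - specialize (H (- x) ltac:(lra)). rewrite Ropp_involutive in H.
    rewrite !Rabs_left; lra.
Qed.

Definition denom (t : R) : R := 1 - 2 * exp (- t) * cos t + exp (- 2 * t).

Lemma exp_double t : exp (- 2 * t) = exp (- t) ^ 2.
Proof. simpl; rewrite Rmult_1_r, <- exp_plus; f_equal; ring. Qed.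

(** Since cos t <= 1, [denom t] is at least (1 - exp (- t)) ^ 2 = exp (- t) (2 sinh (t / 2)) ^ 2,
    and |2 sinh (t / 2)| >= |t / 2|. The factor exp (- t) is kept because it cancels later against
    the same factor in the estimates. *)
Lemma denom_lower t : exp (- t) * t ^ 2 <= 4 * denom t.
Proof.
  unfold denom. rewrite exp_double.
  pose proof (exp_minus_exp_opp_abs (t / 2)) as H.
  set (u := exp (t / 2)) in *. set (v := exp (- (t / 2))) in *.
  assert (Huv : u * v = 1).
  { unfold u, v; rewrite <- exp_plus, <- exp_0; f_equal; ring. }
  assert (Hq : exp (- t) = v ^ 2).
  { unfold v; simpl; rewrite Rmult_1_r, <- exp_plus; f_equal; field. }
  rewrite Hq.
  assert (Hsq : (t / 2) ^ 2 <= (u - v) ^ 2).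
  { rewrite <- (pow2_abs (t / 2)), <- (pow2_abs (u - v)).
    apply pow_incr; split; [apply Rabs_pos | exact H]. }
  pose proof (COS_bound t). pose proof (pow2_ge_0 v).
  assert (v ^ 2 * (u - v) ^ 2 = (1 - v ^ 2) ^ 2).
  { rewrite <- Huv; ring. }
  assert (v ^ 2 * (t / 2) ^ 2 <= v ^ 2 * (u - v) ^ 2) by (apply Rmult_le_compat_l; lra).
  assert (v ^ 2 * cos t <= v ^ 2 * 1) by (apply Rmult_le_compat_l; lra).
  nra.
Qed.

Lemma denom_pos t : t <> 0 -> 0 < denom t.
Proof.
  intros Ht. pose proof (denom_lower t). pose proof (exp_pos (- t)).
  pose proof (pow2_gt_0 t Ht). nra.
Qed.

Lemma f1_i_denom t : t <> 0 -> 2 * f1_i t * denom t = 1 + cos t.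
Proof.
  intros Ht. pose proof (denom_pos t Ht). unfold f1_i. fold (denom t).
  replace (cos t) with (2 * cos (t / 2) ^ 2 - 1).
  - field; lra.
  - replace t with (2 * (t / 2)) at 2 by field. rewrite cos_2a_cos. ring.
Qed.

(** Near 0 the function grows at most like t ^ -2, which two of the powers of t in the integrand
    absorb. *)
Lemma f1_i_abs_le t : t <> 0 -> Rabs (exp (- t) * f1_i t) * t ^ 2 <= 4.
Proof.
  intros Ht. pose proof (denom_pos t Ht). pose proof (f1_i_denom t Ht).
  pose proof (denom_lower t). pose proof (COS_bound t). pose proof (exp_pos (- t)).
  assert (0 <= f1_i t).
  { apply Rmult_le_reg_r with (denom t); lra. }
  assert (f1_i t * denom t <= 1) by lra.
  rewrite Rabs_pos_eq by (apply Rmult_le_pos; lra).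
  assert (f1_i t * (exp (- t) * t ^ 2) <= f1_i t * (4 * denom t))
    by (apply Rmult_le_compat_l; lra).
  lra.
Qed.

(** Divide [kernel_gen_sum] by [denom t]: the two end terms are bounded by [kernel_abs_le], and the
    division costs the factor t ^ 2 through [denom_lower]. *)
Lemma f1_i_approx t N : 0 < t ->
  Rabs (2 * (exp (- t) * f1_i t)
        - sum_f_R0 (fun m => exp (- t) ^ m * kernel t m) N) * t ^ 2
  <= 8 * (2 * INR N + 1) * exp (- t) ^ N.
Proof.
  intros Ht. pose proof (denom_pos t ltac:(lra)) as Hd.
  pose proof (f1_i_denom t ltac:(lra)) as Hf.
  pose proof (denom_lower t) as Hl. pose proof (kernel_gen_sum (exp (- t)) t N) as Hg.
  rewrite <- exp_double in Hg. fold (denom t) in Hg.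
  set (q := exp (- t)) in *. set (S0 := sum_f_R0 _ N) in *.
  assert (Hq : 0 < q) by apply exp_pos.
  assert (HqN : 0 < q ^ N) by (apply pow_lt; exact Hq).
  assert (He : (2 * (q * f1_i t) - S0) * denom t
               = q ^ N * q * (kernel t (S N) - q * kernel t N)).
  { replace ((2 * (q * f1_i t) - S0) * denom t)
      with (q * (2 * f1_i t * denom t) - denom t * S0) by ring.
    rewrite Hf, Hg. simpl; ring. }
  assert (Hq1 : q < 1) by (unfold q; rewrite <- exp_0; apply exp_increasing; lra).
  assert (HK : Rabs (kernel t (S N) - q * kernel t N) <= 2 * (2 * INR N + 1)).
  { pose proof (kernel_abs_le t (S N)) as K1. pose proof (kernel_abs_le t N) as K2.
    rewrite S_INR in K1. pose proof (pos_INR N).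
    unfold Rminus. eapply Rle_trans; [apply Rabs_triang|].
    rewrite Rabs_Ropp, Rabs_mult, (Rabs_pos_eq q) by lra.
    assert (q * Rabs (kernel t N) <= 1 * (2 * INR N))
      by (apply Rmult_le_compat; try lra; apply Rabs_pos).
    nra. }
  assert (HA : Rabs (2 * (q * f1_i t) - S0) * denom t
               <= q ^ N * q * (2 * (2 * INR N + 1))).
  { rewrite <- (Rabs_pos_eq (denom t)) by lra. rewrite <- Rabs_mult, He, Rabs_mult.
    rewrite (Rabs_pos_eq (q ^ N * q)) by nra.
    apply Rmult_le_compat_l; [nra | exact HK]. }
  set (A := Rabs (2 * (q * f1_i t) - S0)) in *. assert (0 <= A) by apply Rabs_pos.
  (* Multiplying by q matches the exp (- t) of [denom_lower]; the extra factor q in [HA] pays for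
     it. *)
  apply Rmult_le_reg_l with q; [exact Hq|].
  assert (A * (q * t ^ 2) <= A * (4 * denom t)) by (apply Rmult_le_compat_l; lra).
  apply Rle_trans with (A * (q * t ^ 2)); [right; ring|].
  apply Rle_trans with (4 * (A * denom t)); [lra|].
  apply Rle_trans with (4 * (q ^ N * q * (2 * (2 * INR N + 1)))); [lra | right; ring].
Qed.

(** * Laplace integrals *)

Lemma exp_pow x n : exp x ^ n = exp (INR n * x).
Proof.
  induction n as [|n IH].
  - simpl. rewrite Rmult_0_l, exp_0; reflexivity.
  - rewrite S_INR, Rmult_plus_distr_r, exp_plus, <- IH, Rmult_1_l. simpl; ring.
Qed.

(** [is_derive_ext] states its side condition in the carrier of a normed module; [ring] works once
    the equation is restated over [R]. *)
Ltac as_real_eq := match goal with |- ?x = ?y => change (@eq R x y) end.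

(** The complex exponential exp (- l t), by its real and imaginary parts. *)
Definition cexp_neg (l : Complex.C) (t : R) : Complex.C :=
  (exp (- (Re l * t)) * cos (Im l * t), - (exp (- (Re l * t)) * sin (Im l * t))).

(* An antiderivative of [t ^ p * cexp_neg l t], by repeated integration by parts. *)
Fixpoint laplace_prim (l : Complex.C) (p : nat) (t : R) : Complex.C :=
  match p with
  | O => (- / l * cexp_neg l t)%C
  | S p' => (/ l * (RtoC (INR p) * laplace_prim l p' t
                    - RtoC (t ^ p) * cexp_neg l t))%C
  end.

Lemma Cinv_coords (l : Complex.C) : l <> RtoC 0 ->
  Re (/ l)%C * Re l - Im (/ l)%C * Im l = 1
  /\ Re (/ l)%C * Im l + Im (/ l)%C * Re l = 0.
Proof.
  intros Hl. pose proof (Cinv_l l Hl) as H. split.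
  - rewrite <- re_mult, H. reflexivity.
  - rewrite <- im_mult, H. reflexivity.
Qed.

Lemma is_derive_cexp_re l t :
  is_derive (fun t => Re (cexp_neg l t)) t
    (- (Re l * Re (cexp_neg l t) - Im l * Im (cexp_neg l t))).
Proof.
  unfold cexp_neg; cbn [Re Im fst snd]. auto_derive; [easy|]. unfold Re, Im; ring.
Qed.

Lemma is_derive_cexp_im l t :
  is_derive (fun t => Im (cexp_neg l t)) t
    (- (Re l * Im (cexp_neg l t) + Im l * Re (cexp_neg l t))).
Proof.
  unfold cexp_neg; cbn [Re Im fst snd]. auto_derive; [easy|]. unfold Re, Im; ring.
Qed.

(** The function [cexp_neg l] satisfies f' = - l f, and in the induction the derivative of the lower
    antiderivative cancels that of the power of t. Real and imaginary parts share one induction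
    because multiplication by 1 / l mixes them. *)
Lemma is_derive_laplace_prim l p t : l <> RtoC 0 ->
  is_derive (fun t => Re (laplace_prim l p t)) t (t ^ p * Re (cexp_neg l t))
  /\ is_derive (fun t => Im (laplace_prim l p t)) t (t ^ p * Im (cexp_neg l t)).
Proof.
  intros Hl. destruct (Cinv_coords l Hl) as [Ha Hc].
  pose proof (is_derive_cexp_re l) as E1. pose proof (is_derive_cexp_im l) as E2.
  set (u := fun t => Re (cexp_neg l t)) in *. set (v := fun t => Im (cexp_neg l t)) in *.
  set (a := Re (/ l)%C) in *. set (c := Im (/ l)%C) in *.
  set (x := Re l) in *. set (y := Im l) in *.
  assert (Du : forall s, Derive u s = - (x * u s - y * v s))
    by (intros s; apply is_derive_unique, E1).
  assert (Dv : forall s, Derive v s = - (x * v s + y * u s))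
    by (intros s; apply is_derive_unique, E2).
  assert (Xu : forall s, ex_derive u s) by (intros s; eexists; apply E1).
  assert (Xv : forall s, ex_derive v s) by (intros s; eexists; apply E2).
  revert t; induction p as [|p IH]; intros t.
  - split.
    + apply is_derive_ext with (fun t => - a * u t + c * v t).
      { intros s. as_real_eq. cbn [laplace_prim]. rewrite re_mult, re_opp, im_opp.
        fold a c; unfold u, v; ring. }
      auto_derive; [repeat split; auto|].
      change (Derive (fun x => u x) t) with (Derive u t).
      change (Derive (fun x => v x) t) with (Derive v t).
      rewrite Du, Dv. change (Re (cexp_neg l t)) with (u t).
      (* The coefficients of u and v are grouped into the two expressions that [Cinv_coords]
         evaluates to 1 and 0. *)
      replace (_ + _) with ((a * x - c * y) * u t - (a * y + c * x) * v t) by ring.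
      rewrite Ha, Hc; simpl; ring.
    + apply is_derive_ext with (fun t => - a * v t - c * u t).
      { intros s. as_real_eq. cbn [laplace_prim]. rewrite im_mult, re_opp, im_opp.
        fold a c; unfold u, v; ring. }
      auto_derive; [repeat split; auto|].
      change (Derive (fun x => u x) t) with (Derive u t).
      change (Derive (fun x => v x) t) with (Derive v t).
      rewrite Du, Dv. change (Im (cexp_neg l t)) with (v t).
      replace (_ + _) with ((a * x - c * y) * v t + (a * y + c * x) * u t) by ring.
      rewrite Ha, Hc; simpl; ring.
  - set (f := fun t => Re (laplace_prim l p t)) in *.
    set (g := fun t => Im (laplace_prim l p t)) in *.
    assert (Df : forall s, Derive f s = s ^ p * u s)
      by (intros s; apply is_derive_unique, IH).
    assert (Dg : forall s, Derive g s = s ^ p * v s)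
      by (intros s; apply is_derive_unique, IH).
    assert (Xf : forall s, ex_derive f s) by (intros s; exists (s ^ p * u s); exact (proj1 (IH s))).
    assert (Xg : forall s, ex_derive g s) by (intros s; exists (s ^ p * v s); exact (proj2 (IH s))).
    set (n := INR (S p)).
    split.
    + apply is_derive_ext with (fun t => a * (n * f t - t ^ S p * u t)
                                         - c * (n * g t - t ^ S p * v t)).
      { intros s. as_real_eq. cbn [laplace_prim]. fold n.
        rewrite re_mult, <- !scal_R_Cmult.
        cbn [Re Im]; unfold f, g, u, v, a, c, Re, Im; simpl; unfold scal; simpl;
          unfold mult; simpl; ring. }
      auto_derive; [repeat split; auto|].
      change (Derive (fun x => u x) t) with (Derive u t).
      change (Derive (fun x => v x) t) with (Derive v t).
      change (Derive (fun x => f x) t) with (Derive f t).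
      change (Derive (fun x => g x) t) with (Derive g t).
      rewrite Du, Dv, Df, Dg. change (Re (cexp_neg l t)) with (u t).
      (* [auto_derive] returns the exponent as an unfolded [INR (S p)]; it has to become the same
         atom n for [ring]. *)
      change (match p with O => 1 | S _ => INR p + 1 end) with n.
      transitivity (t ^ S p * ((a * x - c * y) * u t - (a * y + c * x) * v t));
        [simpl; ring|].
      rewrite Ha, Hc; ring.
    + apply is_derive_ext with (fun t => a * (n * g t - t ^ S p * v t)
                                         + c * (n * f t - t ^ S p * u t)).
      { intros s. as_real_eq. cbn [laplace_prim]. fold n.
        rewrite im_mult, <- !scal_R_Cmult.
        cbn [Re Im]; unfold f, g, u, v, a, c, Re, Im; simpl; unfold scal; simpl;
          unfold mult; simpl; ring. }
      auto_derive; [repeat split; auto|].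
      change (Derive (fun x => u x) t) with (Derive u t).
      change (Derive (fun x => v x) t) with (Derive v t).
      change (Derive (fun x => f x) t) with (Derive f t).
      change (Derive (fun x => g x) t) with (Derive g t).
      rewrite Du, Dv, Df, Dg. change (Im (cexp_neg l t)) with (v t).
      change (match p with O => 1 | S _ => INR p + 1 end) with n.
      transitivity (t ^ S p * ((a * x - c * y) * v t + (a * y + c * x) * u t));
        [simpl; ring|].
      rewrite Ha, Hc; ring.
Qed.

(** For p >= 1 the boundary term vanishes at 0, so only the factors p / l accumulate. With decay at
    infinity this is, up to sign, the Laplace integral p! / l ^ (p + 1). *)
Lemma laplace_prim_0 l p :
  laplace_prim l p 0 = (- RtoC (INR (fact p)) * (/ l) ^ S p)%C.
Proof.
  assert (E : cexp_neg l 0 = RtoC 1).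
  { unfold cexp_neg. rewrite !Rmult_0_r, Ropp_0, exp_0, cos_0, sin_0.
    apply injective_projections; simpl; ring. }
  induction p as [|p IH]; cbn [laplace_prim]; rewrite E.
  - simpl. ring.
  - rewrite IH, pow_ne_zero by easy.
    change (fact (S p)) with (S p * fact p)%nat. rewrite mult_INR, RtoC_mult.
    rewrite (Cpow_S (/ l) (S p)). ring.
Qed.

Lemma Cmod_cexp_neg l t : Cmod (cexp_neg l t) = exp (- (Re l * t)).
Proof.
  unfold Cmod, cexp_neg; cbn [fst snd].
  replace (_ + _) with ((exp (- (Re l * t))) ^ 2).
  - apply sqrt_pow2, Rlt_le, exp_pos.
  - pose proof (sin2_cos2 (Im l * t)) as H. unfold Rsqr in H.
    transitivity (exp (- (Re l * t)) ^ 2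
       * (sin (Im l * t) * sin (Im l * t) + cos (Im l * t) * cos (Im l * t)));
      [rewrite H|]; ring.
Qed.

(** With m = n + 1, exp t = exp (t / m) ^ m >= (t / m) ^ m, whence M = m ^ m. A multiple of 1 / t is
    the common form in which all boundary terms at infinity are bounded. *)
Lemma pow_exp_opp_le n : exists M, 0 <= M /\ forall t, 0 < t -> t ^ n * exp (- t) <= M / t.
Proof.
  exists (INR (S n) ^ S n). split; [apply pow_le, pos_INR|].
  intros t Ht. set (m := INR (S n)).
  assert (Hm : 0 < m) by (apply lt_0_INR; lia).
  assert (H : (t / m) ^ S n <= exp t).
  { replace (exp t) with (exp (t / m) ^ S n).
    - apply pow_incr; split.
      + apply Rlt_le, Rdiv_lt_0_compat; lra.
      + pose proof (exp_ineq1_le (t / m)). lra.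
    - rewrite exp_pow. f_equal. fold m. field; lra. }
  unfold Rdiv in H. rewrite Rpow_mult_distr, pow_inv in H.
  assert (Hp : 0 < m ^ S n) by (apply pow_lt; lra).
  apply Rmult_le_reg_r with (t * exp t); [apply Rmult_lt_0_compat; [lra|apply exp_pos]|].
  replace (t ^ n * exp (- t) * (t * exp t)) with (t ^ S n * (exp t * exp (- t)))
    by (simpl; ring).
  rewrite <- exp_plus, Rplus_opp_r, exp_0, Rmult_1_r.
  replace (m ^ S n / t * (t * exp t)) with (m ^ S n * exp t) by (field; lra).
  replace (t ^ S n) with (m ^ S n * (t ^ S n * / m ^ S n)) by (field; lra).
  apply Rmult_le_compat_l; lra.
Qed.

(** The condition Re l >= 1 compares |exp (- l t)| with exp (- t); all points of the sector satisfy
    it, since there m >= 1. *)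
Lemma laplace_prim_bound l p : 1 <= Re l ->
  exists K, 0 <= K /\ forall t, 0 < t -> Cmod (laplace_prim l p t) <= K / t.
Proof.
  intros Hl.
  assert (HE : forall n, exists M, 0 <= M /\ forall t, 0 < t ->
            t ^ n * Cmod (cexp_neg l t) <= M / t).
  { intros n. destruct (pow_exp_opp_le n) as (M & HM & H). exists M; split; [exact HM|].
    intros t Ht. apply Rle_trans with (2 := H t Ht). rewrite Cmod_cexp_neg.
    apply Rmult_le_compat_l; [apply pow_le; lra|].
    assert (HH : - (Re l * t) <= - t) by nra.
    destruct HH as [HH| ->]; [apply Rlt_le, exp_increasing, HH | lra]. }
  induction p as [|p (K & HK & IH)].
  - destruct (HE O) as (M & HM & H). exists (Cmod (/ l) * M). split.
    + apply Rmult_le_pos; [apply Cmod_ge_0 | exact HM].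
    + intros t Ht. specialize (H t Ht). simpl pow in H. cbn [laplace_prim].
      rewrite Cmod_mult, Cmod_opp. unfold Rdiv; rewrite Rmult_assoc.
      apply Rmult_le_compat_l; [apply Cmod_ge_0|]. unfold Rdiv in H; lra.
  - destruct (HE (S p)) as (M & HM & H). exists (Cmod (/ l) * (INR (S p) * K + M)). split.
    + apply Rmult_le_pos; [apply Cmod_ge_0|].
      pose proof (pos_INR (S p)). pose proof (Rmult_le_pos _ _ H0 HK). lra.
    + intros t Ht. specialize (H t Ht). specialize (IH t Ht). cbn [laplace_prim].
      rewrite Cmod_mult. unfold Rdiv; rewrite Rmult_assoc.
      apply Rmult_le_compat_l; [apply Cmod_ge_0|].
      unfold Cminus. eapply Rle_trans; [apply Cmod_triangle|].
      rewrite Cmod_opp, !Cmod_mult, !Cmod_R, !Rabs_pos_eq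
        by (apply pos_INR || (apply pow_le; lra)).
      pose proof (Rmult_le_compat_l _ _ _ (pos_INR (S p)) IH). unfold Rdiv in *. lra.
Qed.

(** For real l = m > 0 the antiderivative is - exp (- m t) times a polynomial with nonnegative
    coefficients. Dropping its value at b bounds an integral over [0, b] by the full Laplace
    integral. *)
Lemma laplace_prim_nonpos m p t : 0 < m -> 0 <= t ->
  Re (laplace_prim (RtoC m) p t) <= 0.
Proof.
  intros Hm Ht.
  assert (Hi : forall z : Complex.C, Re (/ RtoC m * z)%C = Re z / m).
  { intros z. rewrite <- RtoC_inv by lra. rewrite re_scal_l. unfold Rdiv; ring. }
  assert (He : 0 <= Re (cexp_neg (RtoC m) t)).
  { unfold cexp_neg; simpl. rewrite Rmult_0_l, cos_0.
    pose proof (exp_pos (- (m * t))). lra. }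
  assert (Hm' : 0 <= / m) by (apply Rlt_le, Rinv_0_lt_compat, Hm).
  induction p as [|p IH]; cbn [laplace_prim].
  - replace (- / RtoC m * cexp_neg (RtoC m) t)%C
      with (/ RtoC m * (- cexp_neg (RtoC m) t))%C by ring.
    rewrite Hi, re_opp. unfold Rdiv. nra.
  - rewrite Hi. unfold Cminus. rewrite re_plus, re_opp, !re_scal_l.
    pose proof (Rmult_le_pos _ _ (pow_le _ (S p) Ht) He).
    pose proof (pos_INR (S p)). unfold Rdiv.
    set (X := Re (laplace_prim (RtoC m) p t)) in *.
    assert (0 <= INR (S p) * (- X)) by (apply Rmult_le_pos; lra).
    nra.
Qed.

Lemma RInt_pow_exp_le m p b : 0 < m -> 0 <= b ->
  exists v, is_RInt (fun t => t ^ p * exp (- (m * t))) 0 b v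
            /\ v <= INR (fact p) / m ^ S p.
Proof.
  intros Hm Hb.
  assert (Hm0 : RtoC m <> RtoC 0) by (intros H; apply RtoC_inj in H; lra).
  exists (minus (Re (laplace_prim (RtoC m) p b)) (Re (laplace_prim (RtoC m) p 0))).
  split.
  - apply (is_RInt_derive (fun t => Re (laplace_prim (RtoC m) p t))
             (fun t => t ^ p * exp (- (m * t)))).
    + intros x _. destruct (is_derive_laplace_prim (RtoC m) p x Hm0) as [D _].
      replace (Re (cexp_neg (RtoC m) x)) with (exp (- (m * x))) in D; [exact D|].
      unfold cexp_neg; simpl. rewrite Rmult_0_l, cos_0; ring.
    + intros x _. apply (ex_derive_continuous (fun t => t ^ p * exp (- (m * t)))).
      auto_derive; easy.
  - pose proof (laplace_prim_nonpos m p b Hm Hb).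
    rewrite laplace_prim_0, Cpow_inv by exact Hm0.
    rewrite <- RtoC_pow, <- RtoC_inv by (apply pow_nonzero; lra).
    rewrite <- RtoC_opp, <- RtoC_mult, re_RtoC.
    change (Re (laplace_prim (RtoC m) p b) - (- INR (fact p) * / m ^ S p)
            <= INR (fact p) / m ^ S p).
    unfold Rdiv; lra.
Qed.

(** * The improper integral as a sector sum *)

Lemma half_sum_ext (phi psi : nat -> R) m :
  (forall n, phi n = psi n) -> half_sum phi m = half_sum psi m.
Proof.
  intros H; induction m as [|m IH]; cbn [half_sum]; [reflexivity|].
  rewrite IH, !H; reflexivity.
Qed.

Lemma half_sum_scal (c : R) (phi : nat -> R) m :
  half_sum (fun n => c * phi n) m = c * half_sum phi m.
Proof.
  induction m as [|m IH]; cbn [half_sum]; [ring|]. rewrite IH; ring.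
Qed.

Lemma is_derive_half_sum (f : nat -> R -> R) (d : nat -> R) (t : R) m :
  (forall n, is_derive (f n) t (d n)) ->
  is_derive (fun s => half_sum (fun n => f n s) m) t (half_sum d m).
Proof.
  intros H; induction m as [|m IH]; cbn [half_sum].
  - exact (is_derive_const 0 t).
  - exact (is_derive_plus _ _ _ _ _ (is_derive_plus _ _ _ _ _ IH (H m)) (H (S m))).
Qed.

Definition bounded_by_inv (f : R -> R) : Prop :=
  exists K, 0 <= K /\ forall t, 0 < t -> Rabs (f t) <= K / t.

Lemma bounded_by_inv_0 : bounded_by_inv (fun _ => 0).
Proof.
  exists 0; split; [lra|]. intros t Ht. rewrite Rabs_R0. unfold Rdiv; lra.
Qed.

Lemma bounded_by_inv_plus f g :
  bounded_by_inv f -> bounded_by_inv g -> bounded_by_inv (fun t => f t + g t).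
Proof.
  intros (K & HK & Hf) (M & HM & Hg). exists (K + M); split; [lra|].
  intros t Ht. specialize (Hf t Ht). specialize (Hg t Ht).
  pose proof (Rabs_triang (f t) (g t)). unfold Rdiv in *. lra.
Qed.

Lemma bounded_by_inv_half_sum (f : nat -> R -> R) m :
  (forall n, bounded_by_inv (f n)) ->
  bounded_by_inv (fun t => half_sum (fun n => f n t) m).
Proof.
  intros H; induction m as [|m IH]; cbn [half_sum].
  - apply bounded_by_inv_0.
  - apply bounded_by_inv_plus; [apply bounded_by_inv_plus|]; auto.
Qed.

(** Only real parts are kept because m + n i and m - n i contribute conjugate values, so a sum
    symmetric in n is real. *)
Definition inv_pow_re (s m n : nat) : R := Re ((/ (INR m, INR n)) ^ s)%C.

Definition sector_sum (s N : nat) : R :=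
  sum_f_R0 (fun m => half_sum (inv_pow_re s m) m) N.

Definition sector_prim (p N : nat) (t : R) : R :=
  sum_f_R0 (fun m => half_sum (fun n => Re (laplace_prim (INR m, INR n) p t)) m) N.

Lemma sector_point_neq_0 m n : (INR (S m), INR n) <> RtoC 0.
Proof.
  intros H. apply (f_equal fst) in H. cbn [fst RtoC] in H.
  pose proof (lt_0_INR (S m) ltac:(lia)). lra.
Qed.

(** As exp (- m t) cos (n t) is the real part of exp (- (m + n i) t), the weighted sum over row m is
    exp (- m t) times [kernel t m]. *)
Lemma is_derive_sector_prim p N t :
  is_derive (sector_prim p N) t
    (t ^ p * sum_f_R0 (fun m => exp (- t) ^ m * kernel t m) N).
Proof.
  unfold sector_prim. induction N as [|N IH].
  - cbn [sum_f_R0 half_sum]. unfold kernel; cbn [half_sum].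
    rewrite !Rmult_0_r. exact (is_derive_const 0 t).
  - rewrite tech5, Rmult_plus_distr_l.
    apply (is_derive_plus _ _ _ _ _ IH).
    replace (t ^ p * (exp (- t) ^ S N * kernel t (S N)))
      with (half_sum (fun n => t ^ p * Re (cexp_neg (INR (S N), INR n) t)) (S N)).
    + apply is_derive_half_sum. intros n.
      exact (proj1 (is_derive_laplace_prim _ p t (sector_point_neq_0 N n))).
    + rewrite half_sum_scal. unfold kernel.
      rewrite <- (half_sum_scal (exp (- t) ^ S N)). f_equal.
      apply half_sum_ext. intros n. unfold cexp_neg. cbn [Re Im fst snd].
      rewrite exp_pow. do 2 f_equal; ring.
Qed.

Lemma sector_prim_0 p N :
  sector_prim p N 0 = - (INR (fact p) * sector_sum (S p) N).
Proof.
  unfold sector_prim, sector_sum.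
  rewrite <- Ropp_mult_distr_l_reverse, scal_sum. apply sum_eq. intros m _.
  rewrite Rmult_comm, <- half_sum_scal. apply half_sum_ext. intros n.
  rewrite laplace_prim_0, <- RtoC_opp, re_scal_l. reflexivity.
Qed.

Lemma sector_prim_bound p N : bounded_by_inv (sector_prim p N).
Proof.
  unfold sector_prim. induction N as [|N IH].
  - cbn [sum_f_R0 half_sum]. apply bounded_by_inv_0.
  - cbn [sum_f_R0].
    refine (bounded_by_inv_plus _ _ IH _).
    apply (bounded_by_inv_half_sum
             (fun n t => Re (laplace_prim (INR (S N), INR n) p t)) (S N)).
    intros n. destruct (laplace_prim_bound (INR (S N), INR n) p) as (K & HK & H).
    + unfold Re; cbn [fst]. rewrite S_INR. pose proof (pos_INR N). lra.
    + exists K; split; [exact HK|]. intros t Ht.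
      eapply Rle_trans; [apply re_le_Cmod | apply H, Ht].
Qed.

Definition integrand (n : nat) (t : R) : R := exp (- t) * f1_i t * t ^ n.

Lemma integrand_abs_le p t : Rabs (integrand (S (S p)) t) <= 4 * Rabs t ^ p.
Proof.
  unfold integrand. destruct (Req_dec t 0) as [->|Ht].
  (* At t = 0 the denominator of [f1_i] is 0 and its value a convention of division; the factor t ^
     (p + 2) makes the product 0 all the same. *)
  - rewrite pow_ne_zero, Rmult_0_r, Rabs_R0 by easy.
    apply Rmult_le_pos; [lra | apply pow_le; lra].
  - replace (t ^ S (S p)) with (t ^ 2 * t ^ p) by (simpl; ring).
    rewrite <- Rmult_assoc, Rabs_mult, RPow_abs.
    apply Rmult_le_compat_r; [apply Rabs_pos|].
    rewrite Rabs_mult, (Rabs_pos_eq (t ^ 2)) by apply pow2_ge_0.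
    apply f1_i_abs_le, Ht.
Qed.

(** Away from 0 the denominator is positive; at 0 the bound 4 |t| ^ p with p >= 1 forces the limit
    0. For p = 0 the limit would be 1 / 2 instead of the value 0. *)
Lemma integrand_continuous p t : (1 <= p)%nat -> continuous (integrand (S (S p))) t.
Proof.
  intros Hp. destruct (Req_dec t 0) as [->|Ht].
  - assert (H0 : integrand (S (S p)) 0 = 0)
      by (unfold integrand; rewrite pow_ne_zero by easy; ring).
    apply continuity_pt_filterlim. intros eps Heps.
    exists (Rmin 1 (eps / 4)). split; [apply Rmin_glb_lt; lra|].
    intros x [_ Hx]. cbn in *. unfold R_dist in *. rewrite H0.
    rewrite Rminus_0_r in *.
    eapply Rle_lt_trans; [apply integrand_abs_le|].
    assert (Rabs x < 1 /\ Rabs x < eps / 4) as [H1 H2].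
    { split; eapply Rlt_le_trans; try exact Hx; [apply Rmin_l | apply Rmin_r]. }
    destruct p as [|p]; [lia|]. simpl pow.
    assert (Rabs x ^ p <= 1 ^ p) by (apply pow_incr; split; [apply Rabs_pos|lra]).
    rewrite pow1 in H. pose proof (Rabs_pos x). nra.
  - pose proof (denom_pos t Ht) as Hd. unfold denom in Hd.
    apply (ex_derive_continuous (integrand (S (S p)))).
    unfold integrand, f1_i. auto_derive. lra.
Qed.

Lemma ex_RInt_integrand p b : (1 <= p)%nat -> ex_RInt (integrand (S (S p))) 0 b.
Proof.
  intros Hp. apply (ex_RInt_continuous (integrand (S (S p)))).
  intros t _. apply integrand_continuous, Hp.
Qed.

Lemma sum_kernel_continuous N t :
  continuous (fun t => sum_f_R0 (fun m => exp (- t) ^ m * kernel t m) N) t.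
Proof.
  assert (Hk : forall m, ex_derive (fun t => kernel t m) t).
  { intros m. eexists. unfold kernel.
    apply (is_derive_half_sum (fun n t => cos (INR n * t))
             (fun n => - (INR n * sin (INR n * t)))).
    intros n. auto_derive; [easy|]. ring. }
  assert (He : forall m, ex_derive (fun t => exp (- t) ^ m * kernel t m) t).
  { intros m. apply ex_derive_mult; [|apply Hk].
    apply ex_derive_pow. auto_derive; easy. }
  apply (ex_derive_continuous
           (fun t => sum_f_R0 (fun m => exp (- t) ^ m * kernel t m) N)).
  induction N as [|N IH]; cbn [sum_f_R0].
  - exact (He O).
  - exact (ex_derive_plus (fun t => sum_f_R0 (fun m => exp (- t) ^ m * kernel t m) N)
             (fun t => exp (- t) ^ S N * kernel t (S N)) t IH (He (S N))).
Qed.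

Lemma is_RInt_sector_prim p N b :
  is_RInt (fun t => t ^ p * sum_f_R0 (fun m => exp (- t) ^ m * kernel t m) N) 0 b
    (sector_prim p N b - sector_prim p N 0).
Proof.
  apply (is_RInt_derive (sector_prim p N)
    (fun t => t ^ p * sum_f_R0 (fun m => exp (- t) ^ m * kernel t m) N)).
  - intros t _. apply is_derive_sector_prim.
  - intros t _. apply (continuous_mult (fun t => t ^ p)).
    + apply (ex_derive_continuous (fun t => t ^ p)). auto_derive; easy.
    + apply sum_kernel_continuous.
Qed.

(** The error of [f1_i_approx] is integrated against t ^ p, two powers of t being spent on the pole.
    The bound is uniform in b and tends to 0 as N grows. *)
Lemma RInt_integrand_approx p N b : (1 <= p)%nat -> (1 <= N)%nat -> 0 <= b ->
  Rabs (2 * RInt (integrand (S (S p))) 0 b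
        - (sector_prim (S (S p)) N b - sector_prim (S (S p)) N 0))
  <= 24 * INR (fact p) / INR N.
Proof.
  intros Hp HN Hb.
  assert (HN1 : 1 <= INR N) by (apply (le_INR 1); lia).
  destruct (RInt_pow_exp_le (INR N) p b ltac:(lra) Hb) as (v & Hv & Hle).
  pose proof (is_RInt_minus _ _ _ _ _ _
    (is_RInt_scal _ _ _ 2 _ (RInt_correct _ _ _ (ex_RInt_integrand p b Hp)))
    (is_RInt_sector_prim (S (S p)) N b)) as HI.
  pose proof (is_RInt_scal _ _ _ (8 * (2 * INR N + 1)) _ Hv) as HJ.
  apply Rle_trans with (8 * (2 * INR N + 1) * v).
  2: {
    (* Since N >= 1, 8 (2 N + 1) <= 24 N. One power of 1 / N in N ^ - (p + 1) absorbs this N and, as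
       p >= 1, at least one more remains. *)
    apply Rle_trans with (24 * INR N * (INR (fact p) / INR N ^ S p)).
    { apply Rle_trans with (8 * (2 * INR N + 1) * (INR (fact p) / INR N ^ S p)).
      - apply Rmult_le_compat_l; lra.
      - apply Rmult_le_compat_r; [|lra]. apply Rmult_le_pos; [apply pos_INR|].
        apply Rlt_le, Rinv_0_lt_compat, pow_lt; lra. }
    destruct p as [|p]; [lia|].
    replace (24 * INR N * (INR (fact (S p)) / INR N ^ S (S p)))
      with (24 * INR (fact (S p)) * / INR N * / INR N ^ p)
      by (simpl pow; field; split; [apply pow_nonzero|]; lra).
    unfold Rdiv.
    assert (H1 : / INR N ^ p <= 1).
    { rewrite <- Rinv_1. apply Rinv_le_contravar; [lra|]. apply pow_R1_Rle; lra. }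
    pose proof (pos_INR (fact (S p))).
    assert (0 <= / INR N) by (apply Rlt_le, Rinv_0_lt_compat; lra).
    rewrite <- (Rmult_1_r (24 * INR (fact (S p)) * / INR N)) at 2.
    apply Rmult_le_compat_l; [|exact H1].
    apply Rmult_le_pos; lra. }
  - refine (norm_RInt_le _ _ 0 b _ _ Hb _ HI HJ).
    intros t [Ht _]. cbv beta.
    change (Rabs (2 * integrand (S (S p)) t
                  - t ^ S (S p) * sum_f_R0 (fun m => exp (- t) ^ m * kernel t m) N)
            <= 8 * (2 * INR N + 1) * (t ^ p * exp (- (INR N * t)))).
    destruct Ht as [Ht|<-].
    + pose proof (f1_i_approx t N Ht) as H. rewrite exp_pow in H.
      unfold integrand.
      set (A := sum_f_R0 _ N) in *.
      replace (2 * (exp (- t) * f1_i t * t ^ S (S p)) - t ^ S (S p) * A)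
        with ((2 * (exp (- t) * f1_i t) - A) * (t ^ 2 * t ^ p)) by (simpl; ring).
      rewrite Rabs_mult, (Rabs_pos_eq (t ^ 2 * t ^ p))
        by (apply Rmult_le_pos; apply pow_le; lra).
      replace (- (INR N * t)) with (INR N * - t) by ring.
      rewrite <- Rmult_assoc, (Rmult_comm (t ^ p)), <- (Rmult_assoc (8 * _)).
      apply Rmult_le_compat_r; [apply pow_le; lra | exact H].
    + unfold integrand. rewrite (pow_ne_zero (S (S p))), !Rmult_0_r, Rmult_0_l by easy.
      rewrite Rminus_0_r, Rabs_R0, Ropp_0, exp_0.
      apply Rmult_le_pos; [lra|]. apply Rmult_le_pos; [apply pow_le|]; lra.
Qed.

(** An exchange of limits: c / N is uniform in b, while K may depend on N, as it does in
    [sector_prim_bound]. Comparing L n and L m with [Phi] at one large b shows that L is Cauchy, and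
    its limit is then that of [Phi]. *)
Lemma double_limit (Phi : R -> R) (L : nat -> R) (c : R) :
  (forall N, (1 <= N)%nat -> exists K, forall b, 1 <= b ->
     Rabs (Phi b - L N) <= c / INR N + K / b) ->
  exists l : R, is_lim_seq L l /\
    forall eps, 0 < eps -> exists M, forall b, b > M -> Rabs (Phi b - l) < eps.
Proof.
  intros H.
  assert (HK : forall N eps, (1 <= N)%nat -> 0 < eps -> exists M, forall b, M <= b ->
             Rabs (Phi b - L N) <= c / INR N + eps).
  { intros N eps HN He. destruct (H N HN) as [K HKb]. exists (1 + Rabs K / eps).
    assert (0 <= Rabs K / eps)
      by (apply Rmult_le_pos; [apply Rabs_pos | apply Rlt_le, Rinv_0_lt_compat, He]).
    intros b Hb. eapply Rle_trans; [apply HKb; lra|]. apply Rplus_le_compat_l.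
    apply Rmult_le_reg_r with b; [lra|].
    unfold Rdiv; rewrite Rmult_assoc, Rinv_l, Rmult_1_r by lra.
    apply Rle_trans with (1 := Rle_abs _).
    replace (Rabs K) with (eps * (Rabs K / eps)) by (field; lra).
    apply Rmult_le_compat_l; lra. }
  assert (HC : forall eps, 0 < eps -> exists N0, (1 <= N0)%nat /\
             forall N, (N0 <= N)%nat -> c / INR N <= eps).
  { intros eps He. destruct (INR_unbounded (Rabs c / eps)) as [n Hn].
    exists (S n). split; [lia|]. intros N HN.
    assert (HnN : INR n < INR N) by (apply lt_INR; lia).
    assert (0 <= Rabs c / eps)
      by (apply Rmult_le_pos; [apply Rabs_pos | apply Rlt_le, Rinv_0_lt_compat, He]).
    apply Rmult_le_reg_r with (INR N); [lra|].
    unfold Rdiv; rewrite Rmult_assoc, Rinv_l, Rmult_1_r by lra.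
    apply Rle_trans with (1 := Rle_abs _).
    replace (Rabs c) with (eps * (Rabs c / eps)) by (field; lra).
    apply Rmult_le_compat_l; lra. }
  assert (HL : ex_finite_lim_seq L).
  { apply ex_lim_seq_cauchy_corr. intros eps. pose proof (cond_pos eps) as He.
    destruct (HC (eps / 8) ltac:(lra)) as (N0 & HN0 & H0).
    exists N0. intros n m Hn Hm.
    destruct (HK n (eps / 8) ltac:(lia) ltac:(lra)) as (M1 & H1).
    destruct (HK m (eps / 8) ltac:(lia) ltac:(lra)) as (M2 & H2).
    (* A common b beyond both thresholds; the four errors eps / 8 add up to less than eps. *)
    set (b := Rmax M1 M2).
    assert (M1 <= b /\ M2 <= b) as [Hb1 Hb2] by (split; [apply Rmax_l|apply Rmax_r]).
    pose proof (H0 n Hn). pose proof (H0 m Hm).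
    pose proof (H1 b Hb1). pose proof (H2 b Hb2).
    replace (L n - L m) with ((Phi b - L m) - (Phi b - L n)) by ring.
    unfold Rminus at 1. eapply Rle_lt_trans; [apply Rabs_triang|].
    rewrite Rabs_Ropp. lra. }
  destruct HL as [l Hl]. exists l. split; [exact Hl|].
  intros eps He. destruct (HC (eps / 4) ltac:(lra)) as (N0 & HN0 & H0).
  apply is_lim_seq_spec in Hl. assert (He4 : 0 < eps / 4) by lra.
  destruct (Hl (mkposreal _ He4)) as [N1 HN1]; cbn [pos] in HN1.
  set (N := Nat.max N0 N1).
  destruct (HK N (eps / 4) ltac:(lia) ltac:(lra)) as (M & HMb).
  exists M. intros b Hb.
  pose proof (H0 N ltac:(lia)).
  assert (Rabs (L N - l) < eps / 4) by (apply HN1; lia). pose proof (HMb b ltac:(lra)).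
  pose proof (Rabs_triang (Phi b - L N) (L N - l)) as Ht.
  replace ((Phi b - L N) + (L N - l)) with (Phi b - l) in Ht by ring. lra.
Qed.

(** The value of the antiderivative at 0 is - (p + 2)! times the sector sum, and its value at b is
    at most K / b. The factor 2 is there because the kernel series sums to 2 exp (- t) f_1(i, t). *)
Lemma improper_integral_sector_sum p : (1 <= p)%nat ->
  exists I : R, improper_int_0_inf (integrand (S (S p))) I /\
    is_lim_seq (sector_sum (S (S (S p)))) (2 * I / INR (fact (S (S p)))).
Proof.
  intros Hp. set (s := S (S p)).
  destruct (double_limit (fun b => 2 * RInt (integrand s) 0 b)
              (fun N => INR (fact s) * sector_sum (S s) N) (24 * INR (fact p)))
    as (l & Hl & HM).
  { intros N HN. destruct (sector_prim_bound s N) as (K & _ & HK). exists K.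
    intros b Hb. pose proof (RInt_integrand_approx p N b Hp HN ltac:(lra)) as H.
    fold s in H. rewrite sector_prim_0 in H. specialize (HK b ltac:(lra)).
    set (X := INR (fact s) * sector_sum (S s) N) in *.
    replace (2 * RInt (integrand s) 0 b - X) with
      ((2 * RInt (integrand s) 0 b - (sector_prim s N b - - X)) + sector_prim s N b) by ring.
    eapply Rle_trans; [apply Rabs_triang|]. lra. }
  exists (l / 2). split.
  - split.
    + intros b _. constructor. apply ex_RInt_Reals_0, ex_RInt_integrand, Hp.
    + intros eps He. destruct (HM (2 * eps) ltac:(lra)) as [M HM'].
      exists M. intros b pr Hb. specialize (HM' b Hb). rewrite <- RInt_Reals.
      replace (2 * RInt (integrand s) 0 b - l)
        with (2 * (RInt (integrand s) 0 b - l / 2)) in HM' by field.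
      rewrite Rabs_mult, (Rabs_pos_eq 2) in HM' by lra. lra.
  - pose proof (INR_fact_neq_0 s) as Hf.
    apply is_lim_seq_ext with (fun N => / INR (fact s) * (INR (fact s) * sector_sum (S s) N)).
    { intros N. field. exact Hf. }
    replace (2 * (l / 2) / INR (fact s)) with (/ INR (fact s) * l) by (field; exact Hf).
    exact (is_lim_seq_scal_l _ (/ INR (fact s)) l Hl).
Qed.

(** * Sums over squares of lattice points *)

(** The indices N and - N enter together, so that in a double sum the step from N to N + 1 adds the
    boundary of the larger square. *)
Fixpoint zsum (N : nat) (f : Z -> R) : R :=
  match N with
  | O => f 0%Z
  | S p => zsum p f + f (Z.of_nat N) + f (- Z.of_nat N)%Z
  end.

Lemma zsum_ext N f g : (forall m, f m = g m) -> zsum N f = zsum N g.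
Proof.
  intros H; induction N as [|N IH]; cbn [zsum]; [apply H|]. rewrite IH, !H; reflexivity.
Qed.

Lemma zsum_plus N f g : zsum N (fun m => f m + g m) = zsum N f + zsum N g.
Proof. induction N as [|N IH]; cbn [zsum]; [reflexivity|]. rewrite IH; ring. Qed.

Lemma zsum_scal N c f : zsum N (fun m => c * f m) = c * zsum N f.
Proof. induction N as [|N IH]; cbn [zsum]; [reflexivity|]. rewrite IH; ring. Qed.

Lemma zsum_opp_index N f : zsum N (fun m => f (- m)%Z) = zsum N f.
Proof.
  induction N as [|N IH]; cbn [zsum]; [reflexivity|].
  rewrite IH, Z.opp_involutive; ring.
Qed.

Lemma zsum_abs_le N f g : (forall m, Rabs (f m) <= g m) -> Rabs (zsum N f) <= zsum N g.
Proof.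
  intros H; induction N as [|N IH]; cbn [zsum]; [apply H|].
  pose proof (H (Z.of_nat (S N))). pose proof (H (- Z.of_nat (S N))%Z).
  eapply Rle_trans; [apply Rabs_triang|].
  pose proof (Rabs_triang (zsum N f) (f (Z.of_nat (S N)))). lra.
Qed.

Lemma zsum_swap N M (f : Z -> Z -> R) :
  zsum N (fun m => zsum M (f m)) = zsum M (fun n => zsum N (fun m => f m n)).
Proof.
  induction N as [|N IH]; cbn [zsum]; [apply zsum_ext; reflexivity|].
  rewrite IH, !zsum_plus. do 2 f_equal; apply zsum_ext; reflexivity.
Qed.

Lemma zsum_sum_f_R0 N J (f : Z -> nat -> R) :
  zsum N (fun m => sum_f_R0 (f m) J) = sum_f_R0 (fun j => zsum N (fun m => f m j)) J.
Proof.
  induction J as [|J IH]; cbn [sum_f_R0]; [reflexivity|].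
  rewrite zsum_plus, IH; reflexivity.
Qed.

(** For even f the two end terms of weight 1/2, at N + 1 and - (N + 1), merge into one full term f
    (N + 1). *)
Lemma zsum_half_sum N (f : Z -> R) : (forall n, f (- n)%Z = f n) ->
  zsum N f + f (Z.of_nat (S N)) = half_sum (fun n => f (Z.of_nat n)) (S N).
Proof.
  intros H; induction N as [|N IH].
  - cbn [zsum half_sum]. simpl Z.of_nat. ring.
  - cbn [zsum]. rewrite H, IH. cbn [half_sum]. ring.
Qed.

Lemma zrange_S N :
  zrange (S N) = (- Z.of_nat (S N))%Z :: zrange N ++ (Z.of_nat (S N) :: nil).
Proof.
  unfold zrange. replace (2 * S N + 1)%nat with (S (S (2 * N + 1))) by lia.
  change (seq 0 (S (S (2 * N + 1)))) with (O :: seq 1 (S (2 * N + 1))).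
  rewrite seq_S, <- seq_shift, map_cons, map_app, map_map.
  cbn [app]. apply f_equal2; [lia|]. apply f_equal2.
  - apply map_ext. intros a. lia.
  - cbn [map]. apply f_equal2; [lia | reflexivity].
Qed.

Lemma fold_right_zrange N f : fold_right Rplus 0 (map f (zrange N)) = zsum N f.
Proof.
  induction N as [|N IH].
  - simpl; ring.
  - rewrite zrange_S, map_cons, map_app. cbn [fold_right map zsum]. rewrite <- IH.
    rewrite fold_right_app. cbn [fold_right].
    assert (HA : forall l a, fold_right Rplus a l = fold_right Rplus 0 l + a).
    { intros l a; induction l as [|b l IHl]; cbn [fold_right]; [ring|].
      rewrite IHl; ring. }
    rewrite HA. ring.
Qed.

Lemma Cre_Csum_app l1 l2 :
  Cre (Csum_list (l1 ++ l2)) = Cre (Csum_list l1) + Cre (Csum_list l2).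
Proof.
  induction l1 as [|a l1 IH].
  - unfold Csum_list, C0, Cre; simpl; ring.
  - change (Cre a + Cre (Csum_list (l1 ++ l2))
            = Cre a + Cre (Csum_list l1) + Cre (Csum_list l2)).
    rewrite IH; ring.
Qed.

Lemma Cre_Csum_map {A : Type} (h : A -> C) l :
  Cre (Csum_list (map h l)) = fold_right Rplus 0 (map (fun a => Cre (h a)) l).
Proof.
  induction l as [|a l IH]; [reflexivity|]. cbn [map fold_right]. rewrite <- IH. reflexivity.
Qed.

Lemma Cre_Csum_zrange2 N (h : Z -> Z -> C) :
  Cre (Csum_list (flat_map (fun m => map (h m) (zrange N)) (zrange N)))
  = zsum N (fun m => zsum N (fun n => Cre (h m n))).
Proof.
  rewrite <- fold_right_zrange.
  enough (H : forall l, Cre (Csum_list (flat_map (fun m => map (h m) (zrange N)) l))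
    = fold_right Rplus 0 (map (fun m => zsum N (fun n => Cre (h m n))) l)) by apply H.
  induction l as [|m l IH]; [reflexivity|].
  cbn [flat_map map fold_right]. rewrite Cre_Csum_app, IH, Cre_Csum_map, fold_right_zrange.
  reflexivity.
Qed.

Definition inv_pow_reZ (s : nat) (m n : Z) : R := Re ((/ (IZR m, IZR n)) ^ s)%C.

Definition square_sum (s N : nat) : R := zsum N (fun m => zsum N (inv_pow_reZ s m)).

Lemma inv_pow_reZ_conj s m n : inv_pow_reZ s m (- n) = inv_pow_reZ s m n.
Proof.
  unfold inv_pow_reZ.
  replace (/ (IZR m, IZR (- n)))%C with (Cconj (/ (IZR m, IZR n))%C).
  - rewrite <- Cpow_conj, re_conj. reflexivity.
  - rewrite opp_IZR. unfold Cconj, Complex.Cinv; cbn [fst snd].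
    replace ((- IZR n) ^ 2) with (IZR n ^ 2) by ring.
    f_equal. unfold Rdiv; ring.
Qed.

(** Negating m turns 1 / mu into - conj (1 / mu). *)
Lemma inv_pow_reZ_neg s m n : inv_pow_reZ s (- m) n = (-1) ^ s * inv_pow_reZ s m n.
Proof.
  unfold inv_pow_reZ.
  replace (/ (IZR (- m), IZR n))%C with (RtoC (-1) * Cconj (/ (IZR m, IZR n)))%C.
  - rewrite Cpow_mult_l, <- RtoC_pow, re_scal_l, <- Cpow_conj, re_conj. reflexivity.
  - rewrite opp_IZR. unfold Cconj, Complex.Cinv, Cmult, RtoC; cbn [fst snd].
    replace ((- IZR m) ^ 2) with (IZR m ^ 2) by ring.
    f_equal; unfold Rdiv; ring.
Qed.

(** With mu = m + n i one has n + m i = i conj mu, and (- i) ^ (2 h) = (-1) ^ h. *)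
Lemma inv_pow_reZ_swap h m n :
  inv_pow_reZ (2 * h) n m = (-1) ^ h * inv_pow_reZ (2 * h) m n.
Proof.
  unfold inv_pow_reZ.
  replace (/ (IZR n, IZR m))%C with (- Ci * Cconj (/ (IZR m, IZR n)))%C.
  - rewrite Cpow_mult_l, (Cpow_mult_r (- Ci)).
    replace ((- Ci) ^ 2)%C with (RtoC (-1)) by
      (apply injective_projections; simpl; ring).
    rewrite <- RtoC_pow, re_scal_l, <- Cpow_conj, re_conj. reflexivity.
  - unfold Cconj, Complex.Cinv, Cmult, Complex.Copp, Ci; cbn [fst snd].
    rewrite (Rplus_comm (IZR n ^ 2)).
    f_equal; unfold Rdiv; ring.
Qed.

(** Both coordinates of the inverse of the origin have numerator 0, hence are 0 by convention, and
    the square sums can run over the origin without a case distinction. *)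
Lemma inv_pow_reZ_0 s : inv_pow_reZ (S s) 0 0 = 0.
Proof.
  unfold inv_pow_reZ. replace (/ (0, 0))%C with (RtoC 0).
  - rewrite Cpow_S, Cmult_0_l. reflexivity.
  - unfold Complex.Cinv, RtoC; cbn [fst snd]. f_equal; unfold Rdiv; ring.
Qed.

Lemma square_sum_odd h N : square_sum (2 * h + 1) N = 0.
Proof.
  assert (H : square_sum (2 * h + 1) N = - 1 * square_sum (2 * h + 1) N); [|lra].
  unfold square_sum at 1. rewrite <- zsum_opp_index. unfold square_sum.
  rewrite <- zsum_scal. apply zsum_ext. intros m.
  rewrite <- zsum_scal. apply zsum_ext. intros n.
  rewrite inv_pow_reZ_neg. f_equal. rewrite Nat.add_1_r. apply pow_1_odd.
Qed.

(** Exchanging m and n preserves the square; up to conjugation, invisible to real parts, it is the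
    rotation by i. For odd h it forces the sum to vanish. *)
Lemma square_sum_rotation h N :
  square_sum (2 * h) N = (-1) ^ h * square_sum (2 * h) N.
Proof.
  unfold square_sum at 1. rewrite zsum_swap. unfold square_sum.
  rewrite <- zsum_scal. apply zsum_ext. intros m.
  rewrite <- zsum_scal. apply zsum_ext. intros n. apply inv_pow_reZ_swap.
Qed.

(** When (-1) ^ h = 1 the summand has all eight symmetries of the square. The boundary added at each
    step splits into four equal sides, and each corner is shared half and half by two sides, which
    is the weight in [half_sum]. *)
Lemma square_sum_sector h N : (1 <= h)%nat -> (-1) ^ h = 1 ->
  square_sum (2 * h) N = 4 * sector_sum (2 * h) N.
Proof.
  intros Hh He. set (s := (2 * h)%nat).
  assert (Hneg : forall m n, inv_pow_reZ s (- m) n = inv_pow_reZ s m n).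
  { intros m n. rewrite inv_pow_reZ_neg. unfold s. rewrite pow_1_even; ring. }
  assert (Hsw : forall m n, inv_pow_reZ s n m = inv_pow_reZ s m n).
  { intros m n. unfold s. rewrite inv_pow_reZ_swap, He; ring. }
  induction N as [|N IH].
  - unfold square_sum, sector_sum; cbn [zsum sum_f_R0 half_sum].
    destruct s as [|s'] eqn:Es; [unfold s in Es; lia|]. rewrite inv_pow_reZ_0; ring.
  - unfold sector_sum in *. rewrite tech5, Rmult_plus_distr_l, <- IH. unfold square_sum.
    assert (Hz : half_sum (inv_pow_re s (S N)) (S N)
      = zsum N (inv_pow_reZ s (Z.of_nat (S N)))
        + inv_pow_reZ s (Z.of_nat (S N)) (Z.of_nat (S N))).
    { rewrite zsum_half_sum by (intros n; apply inv_pow_reZ_conj).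
      apply half_sum_ext. intros n. unfold inv_pow_re, inv_pow_reZ.
      rewrite !INR_IZR_INZ. reflexivity. }
    rewrite Hz. cbn [zsum]. rewrite !zsum_plus.
    rewrite (zsum_ext N (fun m => inv_pow_reZ s m (Z.of_nat (S N)))
               (inv_pow_reZ s (Z.of_nat (S N)))) by (intros m; apply Hsw).
    rewrite (zsum_ext N (fun m => inv_pow_reZ s m (- Z.of_nat (S N)))
               (inv_pow_reZ s (Z.of_nat (S N))))
      by (intros m; rewrite inv_pow_reZ_conj; apply Hsw).
    rewrite (zsum_ext N (inv_pow_reZ s (- Z.of_nat (S N)))
               (inv_pow_reZ s (Z.of_nat (S N)))) by (intros m; apply Hneg).
    rewrite !Hneg, !inv_pow_reZ_conj. ring.
Qed.

(** * Taylor expansion of the Weierstrass partial sums on the real axis *)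

(** The terms at k and - k together are at most 4 / (k (k + 1)) = 4 / k - 4 / (k + 1), so the
    sharper bound 5 - 4 / (N + 1) is inductive; it is attained at N = 0. *)
Lemma zsum_inv_sq_le N : zsum N (fun m => / (1 + IZR m ^ 2)) <= 5.
Proof.
  enough (H : zsum N (fun m => / (1 + IZR m ^ 2)) <= 5 - 4 / INR (S N)).
  { pose proof (lt_0_INR (S N) ltac:(lia)) as Hp.
    assert (0 < 4 / INR (S N)) by (apply Rdiv_lt_0_compat; lra). lra. }
  induction N as [|N IH].
  - simpl. lra.
  - cbn [zsum]. rewrite opp_IZR, <- INR_IZR_INZ.
    replace ((- INR (S N)) ^ 2) with (INR (S N) ^ 2) by ring.
    rewrite (S_INR (S N)). set (k := INR (S N)) in *.
    assert (Hk : 0 < k) by (apply lt_0_INR; lia).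
    assert (/ (1 + k ^ 2) <= 2 * / (k * (k + 1))).
    { replace (2 * / (k * (k + 1))) with (/ (k * (k + 1) / 2)) by (field; lra).
      apply Rinv_le_contravar; nra. }
    replace (5 - 4 / (k + 1)) with (5 - 4 / k + 4 * / (k * (k + 1))) by (field; lra).
    lra.
Qed.

Lemma lattice_norm_ge_1 m n : (m <> 0 \/ n <> 0)%Z -> 1 <= Cmod (IZR m, IZR n).
Proof.
  intros H. rewrite <- sqrt_1. apply sqrt_le_1_alt. cbn [fst snd].
  rewrite !pow_IZR, <- plus_IZR. apply IZR_le.
  change (Z.of_nat 2) with 2%Z. nia.
Qed.

(** A majorant that factors in m and n, so that double sums split. With a = m ^ 2, b = n ^ 2 and a +
    b >= 1 it amounts to (1 + a) (1 + b) <= 3 (a + b) ^ 2. *)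
Lemma lattice_inv_pow4_le m n : (m <> 0 \/ n <> 0)%Z ->
  (/ Cmod (IZR m, IZR n)) ^ 4 <= 3 * (/ (1 + IZR m ^ 2) * / (1 + IZR n ^ 2)).
Proof.
  intros H. pose proof (lattice_norm_ge_1 m n H) as H1.
  rewrite <- Rinv_mult, pow_inv.
  replace (Cmod (IZR m, IZR n) ^ 4) with ((Cmod (IZR m, IZR n) ^ 2) ^ 2) by ring.
  assert (H2 : 1 <= Cmod (IZR m, IZR n) ^ 2) by (apply pow_R1_Rle; exact H1).
  rewrite Cmod2_alt in *. unfold Re, Im in *; cbn [fst snd] in *.
  set (a := IZR m ^ 2) in *. set (b := IZR n ^ 2) in *.
  assert (0 <= a /\ 0 <= b) as [Ha Hb] by (split; apply pow2_ge_0).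
  replace (3 * / ((1 + a) * (1 + b))) with (/ ((1 + a) * (1 + b) / 3))
    by (field; split; lra).
  apply Rinv_le_contravar; nra.
Qed.

(* [1 / (1 - u) ^ 2 = sum_(i <= j) (i + 1) u ^ i + taylor_rem u j]. *)
Definition taylor_rem (u : Complex.C) (j : nat) : Complex.C :=
  (u ^ S j * (RtoC (INR j + 2) - RtoC (INR j + 1) * u) / (1 - u) ^ 2)%C.

Lemma taylor_rem_0 u : (1 - u)%C <> RtoC 0 -> (/ (1 - u) ^ 2 - 1)%C = taylor_rem u 0.
Proof.
  intros Hu. unfold taylor_rem. simpl INR. rewrite !RtoC_plus. field. exact Hu.
Qed.

Lemma taylor_rem_S u j : (1 - u)%C <> RtoC 0 ->
  taylor_rem u j = (RtoC (INR j + 2) * u ^ S j + taylor_rem u (S j))%C.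
Proof.
  intros Hu. unfold taylor_rem. rewrite S_INR, !RtoC_plus, (Cpow_S u (S j)).
  field. exact Hu.
Qed.

(** From |u| <= 1 / 2 come |1 - u| >= 1 / 2, hence the factor 4, and |(j + 2) - (j + 1) u| <= 2 j +
    3. *)
Lemma taylor_rem_le u j : Cmod u <= / 2 ->
  Cmod (taylor_rem u j) <= 4 * (2 * INR j + 3) * Cmod u ^ S j.
Proof.
  intros Hu. unfold taylor_rem. pose proof (pos_INR j) as Hj.
  pose proof (Cmod_ge_0 u) as Hu0.
  assert (H1 : / 2 <= Cmod (1 - u)%C).
  { pose proof (Cmod_triangle (1 - u)%C u) as H.
    replace (1 - u + u)%C with (RtoC 1) in H by ring. rewrite Cmod_1 in H. lra. }
  assert (Hn : ((1 - u) ^ 2)%C <> RtoC 0).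
  { apply Cpow_nz. apply Cmod_gt_0. lra. }
  rewrite Cmod_div, Cmod_mult, !Cmod_pow by exact Hn.
  assert (H2 : Cmod (RtoC (INR j + 2) - RtoC (INR j + 1) * u)%C <= 2 * INR j + 3).
  { unfold Cminus. eapply Rle_trans; [apply Cmod_triangle|].
    rewrite Cmod_opp, Cmod_mult, !Cmod_R, !Rabs_pos_eq by lra. nra. }
  assert (H3 : / Cmod (1 - u)%C ^ 2 <= 4).
  { replace 4 with (/ (/ 2) ^ 2) by field.
    apply Rinv_le_contravar; [|apply pow_incr]; lra. }
  assert (0 <= / Cmod (1 - u)%C ^ 2)
    by (apply Rlt_le, Rinv_0_lt_compat, pow_lt; lra).
  pose proof (pow_le _ (S j) Hu0).
  unfold Rdiv.
  replace (4 * (2 * INR j + 3) * Cmod u ^ S j)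
    with (Cmod u ^ S j * (2 * INR j + 3) * 4) by ring.
  apply Rmult_le_compat; try lra.
  - apply Rmult_le_pos; [lra | apply Cmod_ge_0].
  - apply Rmult_le_compat_l; lra.
Qed.

(** Multiplies the lattice sum of exponent j + 3: exponent 2 is removed by the subtraction of 1 /
    lambda ^ 2, and lambda = w mu supplies the power of 1 / w. *)
Definition wp_coef (w x : R) (j : nat) : R := (INR j + 2) * x ^ S j * (/ w) ^ (j + 3).

(** Put u = x / lambda: the difference is (1 / (1 - u) ^ 2 - 1) / lambda ^ 2. The hypotheses x <= w
    / 2 and |mu| >= 1 give |u| <= 1 / 2 for all nonzero lattice points at once. *)
Lemma shifted_inv_sq_taylor (w x : R) (mu : Complex.C) J :
  0 < w -> 0 < x <= w / 2 -> 1 <= Cmod mu ->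
  let lam := (RtoC w * mu)%C in
  Rabs (Re (/ ((RtoC x - lam) * (RtoC x - lam)) - / (lam * lam))%C
        - sum_f_R0 (fun j => wp_coef w x j * Re ((/ mu) ^ (j + 3))%C) J)
  <= 4 * (2 * INR (S J) + 3) * (/ w) ^ (J + 4) * x ^ (J + 2) * (/ Cmod mu) ^ (J + 4).
Proof.
  intros Hw Hx Hmu lam.
  assert (Hwi : 0 < / w) by (apply Rinv_0_lt_compat, Hw).
  assert (Hmui : 0 < / Cmod mu <= 1).
  { split; [apply Rinv_0_lt_compat; lra|]. rewrite <- Rinv_1.
    apply Rinv_le_contravar; lra. }
  assert (Hmu0 : mu <> RtoC 0) by (apply Cmod_gt_0; lra).
  assert (Hw0 : RtoC w <> RtoC 0) by (intros H; apply RtoC_inj in H; lra).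
  set (u := (RtoC (x * / w) * / mu)%C).
  assert (Hxw : 0 < x * / w <= / 2).
  { split; [apply Rmult_lt_0_compat; lra|].
    apply Rmult_le_reg_r with w; [lra|]. rewrite Rmult_assoc, Rinv_l; lra. }
  assert (Hu : Cmod u = x * / w * / Cmod mu).
  { unfold u. rewrite Cmod_mult, Cmod_R, Cmod_inv, Rabs_pos_eq by (exact Hmu0 || lra).
    reflexivity. }
  assert (Hu2 : Cmod u <= / 2).
  { rewrite Hu. rewrite <- (Rmult_1_r (/ 2)). apply Rmult_le_compat; lra. }
  assert (H1u : (1 - u)%C <> RtoC 0).
  { intros H. assert (Hu1 : u = RtoC 1).
    { replace u with (RtoC 1 - (1 - u))%C by ring. rewrite H; ring. }
    rewrite Hu1, Cmod_1 in Hu2. lra. }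
  assert (Hlam0 : lam <> RtoC 0) by (apply Cmult_neq_0; assumption).
  assert (Hlu : (RtoC x - lam)%C = (- lam * (1 - u))%C).
  { unfold lam, u. rewrite RtoC_mult, RtoC_inv by lra. field. split; assumption. }
  assert (Hmain : (/ ((RtoC x - lam) * (RtoC x - lam)) - / (lam * lam))%C
                  = (/ (lam * lam) * taylor_rem u 0)%C).
  { rewrite <- taylor_rem_0 by exact H1u. rewrite Hlu. field. split; assumption. }
  assert (Hterm : forall j, Re (/ (lam * lam) * (RtoC (INR j + 2) * u ^ S j))%C
                            = wp_coef w x j * Re ((/ mu) ^ (j + 3))%C).
  { intros j. rewrite <- re_scal_l. f_equal. unfold wp_coef, u, lam.
    rewrite Cpow_mult_l, <- RtoC_pow, Rpow_mult_distr, !pow_add, !Cpow_add_r.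
    replace (/ (RtoC w * mu * (RtoC w * mu)))%C
      with (RtoC (/ w) * RtoC (/ w) * (/ mu * / mu))%C
      by (rewrite RtoC_inv by lra; field; split; assumption).
    simpl pow. rewrite !Cpow_S, !RtoC_mult. simpl Cpow. ring. }
  assert (Hsum : forall K, Re (/ (lam * lam) * taylor_rem u 0)%C
    = sum_f_R0 (fun j => wp_coef w x j * Re ((/ mu) ^ (j + 3))%C) K
      + Re (/ (lam * lam) * taylor_rem u (S K))%C).
  (* Each step moves one Taylor term from the remainder to the sum. *)
  { induction K as [|K IH]; [cbn [sum_f_R0] | rewrite IH, tech5, Rplus_assoc; f_equal];
      rewrite taylor_rem_S, Cmult_plus_distr_l, re_plus, Hterm by exact H1u;
      reflexivity. }
  rewrite Hmain, (Hsum J).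
  replace (_ + _ - _) with (Re (/ (lam * lam) * taylor_rem u (S J))%C) by ring.
  eapply Rle_trans; [apply re_le_Cmod|].
  rewrite Cmod_mult, Cmod_inv, Cmod_mult by (apply Cmult_neq_0; exact Hlam0).
  unfold lam at 1 2. rewrite Cmod_mult, Cmod_R, Rabs_pos_eq by lra.
  pose proof (taylor_rem_le u (S J) Hu2) as Hr. rewrite Hu in Hr.
  set (c := Cmod mu) in *.
  replace (4 * (2 * INR (S J) + 3) * (/ w) ^ (J + 4) * x ^ (J + 2) * (/ c) ^ (J + 4))
    with (/ (w * c * (w * c)) * (4 * (2 * INR (S J) + 3) * (x * / w * / c) ^ S (S J))).
  - apply Rmult_le_compat_l; [|exact Hr].
    apply Rlt_le, Rinv_0_lt_compat. repeat apply Rmult_lt_0_compat; lra.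
  - rewrite !Rinv_mult, !Rpow_mult_distr, !pow_add. simpl pow. ring.
Qed.

Definition wp_term (w x : R) (m n : Z) : C :=
  if (Z.eqb m 0 && Z.eqb n 0)%bool then C0
  else let lam := lattice_pt w m n in
       Csub (Cinv (Cmul (Csub (x, 0) lam) (Csub (x, 0) lam)))
            (Cinv (Cmul lam lam)).

Lemma Cinv_eq (z : Complex.C) : Cinv z = (/ z)%C.
Proof.
  unfold Cinv, Complex.Cinv, Cre, Cim. cbn [pow]. rewrite !Rmult_1_r. reflexivity.
Qed.

(** The remainder decays like |mu| ^ - (J + 4), of which four powers go to [lattice_inv_pow4_le] and
    the others are at most 1; 12 = 4 * 3. *)
Lemma wp_term_taylor w x m n J : 0 < w -> 0 < x <= w / 2 ->
  Rabs (Cre (wp_term w x m n)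
        - sum_f_R0 (fun j => wp_coef w x j * inv_pow_reZ (j + 3) m n) J)
  <= 12 * (2 * INR (S J) + 3) * (/ w) ^ (J + 4) * x ^ (J + 2)
     * (/ (1 + IZR m ^ 2) * / (1 + IZR n ^ 2)).
Proof.
  intros Hw Hx.
  assert (Hwi : 0 < / w) by (apply Rinv_0_lt_compat, Hw).
  pose proof (pos_INR (S J)) as HJ.
  assert (Hc : 0 <= 4 * (2 * INR (S J) + 3) * (/ w) ^ (J + 4) * x ^ (J + 2))
    by (repeat apply Rmult_le_pos; try (apply pow_le; lra); lra).
  unfold wp_term.
  destruct (Z.eqb m 0 && Z.eqb n 0)%bool eqn:Hmn.
  - apply andb_prop in Hmn as [Hm Hn]. apply Z.eqb_eq in Hm, Hn. subst.
    rewrite sum_eq_R0.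
    + change (Cre C0) with 0. rewrite Rminus_0_r, Rabs_R0.
      replace (IZR 0 ^ 2) with 0 by (simpl; ring). rewrite Rplus_0_r, Rinv_1. lra.
    + intros j _. rewrite Nat.add_succ_r, inv_pow_reZ_0; ring.
  - assert (H : (m <> 0 \/ n <> 0)%Z).
    { apply Bool.andb_false_iff in Hmn as [Hm|Hn]; [left|right]; apply Z.eqb_neq; assumption. }
    pose proof (lattice_norm_ge_1 m n H) as H1.
    pose proof (shifted_inv_sq_taylor w x (IZR m, IZR n) J Hw Hx H1) as HT.
    cbv zeta in HT.
    assert (El : lattice_pt w m n = (RtoC w * (IZR m, IZR n))%C).
    { unfold lattice_pt. apply injective_projections; simpl; ring. }
    cbv zeta. rewrite El, !Cinv_eq.
    eapply Rle_trans; [exact HT|].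
    replace (12 * (2 * INR (S J) + 3) * (/ w) ^ (J + 4) * x ^ (J + 2)
             * (/ (1 + IZR m ^ 2) * / (1 + IZR n ^ 2)))
      with (4 * (2 * INR (S J) + 3) * (/ w) ^ (J + 4) * x ^ (J + 2)
            * (3 * (/ (1 + IZR m ^ 2) * / (1 + IZR n ^ 2)))) by ring.
    apply Rmult_le_compat_l; [exact Hc|].
    eapply Rle_trans; [|apply lattice_inv_pow4_le, H].
    set (c := Cmod (IZR m, IZR n)) in *.
    assert (Hci : 0 < / c <= 1).
    { split; [apply Rinv_0_lt_compat; lra|]. rewrite <- Rinv_1.
      apply Rinv_le_contravar; lra. }
    rewrite pow_add. rewrite <- (Rmult_1_l ((/ c) ^ 4)) at 2.
    apply Rmult_le_compat_r; [apply pow_le; lra|].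
    rewrite <- (pow1 J). apply pow_incr; lra.
Qed.

(** Summing the factored majorant gives 12 * 5 * 5 = 300. The bound is independent of N, so it
    survives the limit of the square partial sums. *)
Lemma wp_partial_taylor w x J N : 0 < w -> 0 < x <= w / 2 ->
  Rabs (Cre (Csub (wp_partial w (x, 0) N) (Cinv (Cmul (x, 0) (x, 0))))
        - sum_f_R0 (fun j => wp_coef w x j * square_sum (j + 3) N) J)
  <= 300 * (2 * INR (S J) + 3) * (/ w) ^ (J + 4) * x ^ (J + 2).
Proof.
  intros Hw Hx.
  assert (Hwi : 0 < / w) by (apply Rinv_0_lt_compat, Hw).
  pose proof (pos_INR (S J)) as HJ.
  set (c := 12 * (2 * INR (S J) + 3) * (/ w) ^ (J + 4) * x ^ (J + 2)).
  assert (Hc : 0 <= c)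
    by (unfold c; repeat apply Rmult_le_pos; try (apply pow_le; lra); lra).
  replace (Cre (Csub (wp_partial w (x, 0) N) (Cinv (Cmul (x, 0) (x, 0)))))
    with (zsum N (fun m => zsum N (fun n => Cre (wp_term w x m n)))).
  2: { rewrite <- Cre_Csum_zrange2. unfold wp_partial.
       fold (wp_term w x).
       set (A := Cinv _). set (B := Csum_list _).
       change (Cre B = Cre A + Cre B + - Cre A). ring. }
  replace (sum_f_R0 _ J) with (zsum N (fun m => zsum N (fun n =>
    sum_f_R0 (fun j => wp_coef w x j * inv_pow_reZ (j + 3) m n) J))).
  2: { rewrite (zsum_ext N _ (fun m => sum_f_R0 (fun j =>
         zsum N (fun n => wp_coef w x j * inv_pow_reZ (j + 3) m n)) J))
         by (intros m; apply zsum_sum_f_R0).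
       rewrite zsum_sum_f_R0. apply sum_eq. intros j _. unfold square_sum.
       rewrite <- zsum_scal. apply zsum_ext. intros m. apply zsum_scal. }
  replace (zsum N _ - zsum N _) with (zsum N (fun m => zsum N (fun n =>
    Cre (wp_term w x m n)
    + -1 * sum_f_R0 (fun j => wp_coef w x j * inv_pow_reZ (j + 3) m n) J))).
  2: { rewrite (zsum_ext N _ (fun m => zsum N (fun n => Cre (wp_term w x m n))
         + -1 * zsum N (fun n => sum_f_R0 (fun j =>
             wp_coef w x j * inv_pow_reZ (j + 3) m n) J)))
         by (intros m; rewrite zsum_plus, zsum_scal; reflexivity).
       rewrite zsum_plus, zsum_scal. ring. }
  apply Rle_trans with (zsum N (fun m => c * / (1 + IZR m ^ 2)
                                         * zsum N (fun n => / (1 + IZR n ^ 2)))).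
  - apply zsum_abs_le. intros m. rewrite <- zsum_scal. apply zsum_abs_le. intros n.
    pose proof (wp_term_taylor w x m n J Hw Hx) as H. fold c in H.
    replace (Cre (wp_term w x m n) + -1 * _) with (Cre (wp_term w x m n)
      - sum_f_R0 (fun j => wp_coef w x j * inv_pow_reZ (j + 3) m n) J) by ring.
    rewrite Rmult_assoc. exact H.
  - set (S1 := zsum N (fun n => / (1 + IZR n ^ 2))).
    rewrite (zsum_ext N _ (fun m => c * S1 * / (1 + IZR m ^ 2)))
      by (intros m; ring).
    rewrite zsum_scal. fold S1.
    pose proof (zsum_inv_sq_le N) as HS. fold S1 in HS.
    assert (HS0 : 0 <= S1).
    { eapply Rle_trans; [apply Rabs_pos|]. unfold S1.
      apply (zsum_abs_le N (fun _ => 0)). intros m. rewrite Rabs_R0.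
      pose proof (pow2_ge_0 (IZR m)). apply Rlt_le, Rinv_0_lt_compat; lra. }
    replace (300 * (2 * INR (S J) + 3) * (/ w) ^ (J + 4) * x ^ (J + 2))
      with (c * (5 * 5)) by (unfold c; ring).
    rewrite Rmult_assoc. apply Rmult_le_compat_l; [exact Hc|].
    apply Rmult_le_compat; lra.
Qed.

(** * Comparison of Laurent coefficients *)

(** Coefficients vanish one by one: letting x tend to 0 gives d 0 = 0, and dividing by x reduces
    J. *)
Lemma small_poly_zero J (d : nat -> R) (K delta : R) : 0 < delta ->
  (forall x, 0 < x < delta -> Rabs (sum_f_R0 (fun j => d j * x ^ j) J) <= K * x ^ S J) ->
  forall j, (j <= J)%nat -> d j = 0.
Proof.
  intros Hdelta. revert d.
  assert (Hlim : forall c M, (forall x, 0 < x < Rmin 1 delta -> Rabs c <= M * x) -> c = 0).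
  { intros c M H. destruct (Req_dec c 0) as [|Hc]; [assumption|exfalso].
    apply Rabs_pos_lt in Hc.
    assert (Hm : 0 < Rmin 1 delta) by (apply Rmin_glb_lt; lra).
    (* This x stays in range and makes M x at most |c| / 2, against |c| <= M x. *)
    set (x := Rmin (Rmin 1 delta / 2) (Rabs c / (2 * (Rabs M + 1)))).
    pose proof (Rabs_pos M) as HM.
    assert (Hq : 0 < Rabs c / (2 * (Rabs M + 1))) by (apply Rdiv_lt_0_compat; lra).
    assert (Hx : 0 < x) by (apply Rmin_glb_lt; lra).
    pose proof (Rmin_l (Rmin 1 delta / 2) (Rabs c / (2 * (Rabs M + 1)))) as Hx1.
    pose proof (Rmin_r (Rmin 1 delta / 2) (Rabs c / (2 * (Rabs M + 1)))) as Hx2.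
    fold x in Hx1, Hx2. specialize (H x ltac:(lra)).
    assert (M * x <= (Rabs M + 1) * (Rabs c / (2 * (Rabs M + 1)))).
    { apply Rle_trans with ((Rabs M + 1) * x).
      - apply Rmult_le_compat_r; [lra|]. pose proof (Rle_abs M). lra.
      - apply Rmult_le_compat_l; lra. }
    replace ((Rabs M + 1) * (Rabs c / (2 * (Rabs M + 1)))) with (Rabs c / 2) in H0
      by (field; lra).
    lra. }
  induction J as [|J IH]; intros d H j Hj.
  - replace j with O by lia. apply (Hlim _ K). intros x Hx.
    pose proof (Rmin_r 1 delta). specialize (H x ltac:(lra)). simpl in H.
    rewrite !Rmult_1_r in H. exact H.
  - assert (Hsplit : forall x, sum_f_R0 (fun j => d j * x ^ j) (S J)
               = d O + x * sum_f_R0 (fun j => d (S j) * x ^ j) J).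
    { intros x. rewrite decomp_sum, scal_sum by lia. cbn [pred]. f_equal; [simpl; ring|].
      apply sum_eq. intros i _. simpl; ring. }
    assert (Hd0 : d O = 0).
    { apply (Hlim _ (Rabs K + sum_f_R0 (fun j => Rabs (d (S j))) J)). intros x Hx.
      pose proof (Rmin_r 1 delta). pose proof (Rmin_l 1 delta).
      specialize (H x ltac:(lra)). rewrite Hsplit in H.
      set (T := sum_f_R0 (fun j => d (S j) * x ^ j) J) in *.
      assert (HT : Rabs T <= sum_f_R0 (fun j => Rabs (d (S j))) J).
      { eapply Rle_trans; [apply Rsum_abs|]. apply sum_Rle. intros i _.
        rewrite Rabs_mult. rewrite <- (Rmult_1_r (Rabs (d (S i)))) at 2.
        apply Rmult_le_compat_l; [apply Rabs_pos|].
        rewrite Rabs_pos_eq by (apply pow_le; lra).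
        rewrite <- (pow1 i). apply pow_incr; lra. }
      assert (HK : K * x ^ S (S J) <= Rabs K * x).
      { apply Rle_trans with (Rabs K * x ^ S (S J)).
        - apply Rmult_le_compat_r; [apply pow_le; lra | apply Rle_abs].
        - apply Rmult_le_compat_l; [apply Rabs_pos|].
          change (x * x ^ S J <= x). rewrite <- (Rmult_1_r x) at 3.
          apply Rmult_le_compat_l; [lra|].
          rewrite <- (pow1 (S J)). apply pow_incr; lra. }
      replace (d O) with ((d O + x * T) - x * T) by ring.
      eapply Rle_trans; [apply Rabs_triang|].
      rewrite Rabs_Ropp, Rabs_mult, (Rabs_pos_eq x) by lra.
      assert (x * Rabs T <= x * sum_f_R0 (fun j => Rabs (d (S j))) J)
        by (apply Rmult_le_compat_l; lra).
      lra. }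
    destruct j as [|j]; [exact Hd0|].
    apply (IH (fun j => d (S j))); [|lia]. intros x Hx. specialize (H x Hx).
    rewrite Hsplit, Hd0, Rplus_0_l, Rabs_mult, (Rabs_pos_eq x) in H by lra.
    apply Rmult_le_reg_l with x; [lra|].
    replace (x * (K * x ^ S J)) with (K * x ^ S (S J)) by (simpl; ring). exact H.
Qed.

(** Comparison with a geometric series of ratio x / rho <= 1 / 2, whose sum accounts for the factor
    2. *)
Lemma power_series_tail (c : nat -> R) (rho B x : R) J n :
  0 < rho -> (forall j, Rabs (c j * rho ^ j) <= B) -> 0 < x <= rho / 2 ->
  Rabs (sum_f_R0 (fun j => c j * x ^ j) (J + n) - sum_f_R0 (fun j => c j * x ^ j) J)
  <= 2 * B * (x / rho) ^ S J.
Proof.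
  intros Hrho HB Hx.
  assert (HB0 : 0 <= B) by (eapply Rle_trans; [apply Rabs_pos | apply (HB O)]).
  assert (Hy : 0 < x / rho <= / 2).
  { split; [apply Rdiv_lt_0_compat; lra|].
    apply Rmult_le_reg_r with rho; [lra|].
    unfold Rdiv; rewrite Rmult_assoc, Rinv_l; lra. }
  (* The factor 1 - 2 ^ - n makes the bound inductive: it leaves room for the next term. *)
  enough (H : Rabs (sum_f_R0 (fun j => c j * x ^ j) (J + n)
                    - sum_f_R0 (fun j => c j * x ^ j) J)
              <= 2 * B * (x / rho) ^ S J * (1 - (/ 2) ^ n)).
  { eapply Rle_trans; [exact H|]. rewrite <- (Rmult_1_r (2 * B * (x / rho) ^ S J)) at 2.
    assert (0 < (/ 2) ^ n) by (apply pow_lt; lra).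
    apply Rmult_le_compat_l; [|lra].
    apply Rmult_le_pos; [lra | apply pow_le; lra]. }
  induction n as [|n IH].
  - rewrite Nat.add_0_r, Rminus_diag, Rabs_R0. simpl. lra.
  - rewrite Nat.add_succ_r, tech5.
    set (S1 := sum_f_R0 _ (J + n)) in *. set (S0 := sum_f_R0 _ J) in *.
    replace (S1 + c (S (J + n)) * x ^ S (J + n) - S0)
      with ((S1 - S0) + c (S (J + n)) * x ^ S (J + n)) by ring.
    eapply Rle_trans; [apply Rabs_triang|].
    assert (Ht : Rabs (c (S (J + n)) * x ^ S (J + n)) <= B * (x / rho) ^ S J * (/ 2) ^ n).
    { replace (c (S (J + n)) * x ^ S (J + n))
        with (c (S (J + n)) * rho ^ S (J + n) * (x / rho) ^ S (J + n)).
      - rewrite Rabs_mult, (Rabs_pos_eq ((x / rho) ^ _)) by (apply pow_le; lra).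
        change (S (J + n)) with (S J + n)%nat at 3. rewrite pow_add, Rmult_assoc.
        apply Rmult_le_compat; try apply Rabs_pos; auto.
        + apply Rmult_le_pos; apply pow_le; lra.
        + apply Rmult_le_compat_l; [apply pow_le; lra | apply pow_incr; lra].
      - unfold Rdiv. rewrite Rpow_mult_distr, pow_inv.
        field. apply pow_nonzero; lra. }
    replace (2 * B * (x / rho) ^ S J * (1 - (/ 2) ^ S n))
      with (2 * B * (x / rho) ^ S J * (1 - (/ 2) ^ n) + B * (x / rho) ^ S J * (/ 2) ^ n)
      by (simpl pow; field; lra).
    lra.
Qed.

Lemma convergent_terms_bounded (a : nat -> R) (l : R) :
  is_lim_seq (sum_f_R0 a) l -> exists B, forall j, Rabs (a j) <= B.
Proof.
  intros H. apply is_lim_seq_Reals in H.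
  destruct (maj_by_pos _ (exist _ l H)) as (M & HM & HB).
  exists (2 * M). intros [|j].
  - specialize (HB O). simpl in HB. lra.
  - pose proof (HB j). pose proof (HB (S j)). rewrite tech5 in H1.
    replace (a (S j)) with ((sum_f_R0 a j + a (S j)) - sum_f_R0 a j) by ring.
    eapply Rle_trans; [apply Rabs_triang|]. rewrite Rabs_Ropp. lra.
Qed.

Lemma is_lim_seq_abs_diff_le (u v : nat -> R) (a b K : R) (N0 : nat) :
  is_lim_seq u a -> is_lim_seq v b ->
  (forall N, (N0 <= N)%nat -> Rabs (u N - v N) <= K) -> Rabs (a - b) <= K.
Proof.
  intros Hu Hv H.
  pose proof (is_lim_seq_abs _ _ (is_lim_seq_minus' _ _ _ _ Hu Hv)) as HA.
  refine (is_lim_seq_le_loc _ (fun _ => K) (Rabs (a - b)) K _ HA (is_lim_seq_const K)).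
  exists N0. exact H.
Qed.

Lemma Cseq_cv_Cre (u : nat -> C) (l : C) :
  Cseq_cv u l -> is_lim_seq (fun N => Cre (u N)) (Cre l).
Proof.
  intros H. apply is_lim_seq_Reals. intros eps Heps.
  destruct (H eps Heps) as [N0 HN]. exists N0. intros N HN'.
  eapply Rle_lt_trans; [|exact (HN N HN')].
  unfold R_dist, Cnorm, Csub, Cadd, Copp, Cre, Cim; cbn [fst snd].
  rewrite <- sqrt_Rsqr_abs. apply sqrt_le_1_alt. unfold Rsqr.
  pose proof (Rle_0_sqr (snd (u N) + - snd l)). unfold Rsqr in H0. unfold Rminus. lra.
Qed.

Lemma Cpow_real x n : Cpow (x, 0) n = (x ^ n, 0).
Proof.
  induction n as [|n IH]; cbn [Defs.Cpow]; [reflexivity|].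
  rewrite IH. unfold Cmul, Cre, Cim; cbn [fst snd]. f_equal; simpl; ring.
Qed.

Lemma Cre_laurent_partial H x N :
  Cre (laurent_partial H (x, 0) N)
  = sum_f_R0 (fun j => laurent_coef H (j + 2) * x ^ j) N.
Proof.
  unfold laurent_partial. rewrite Cre_Csum_map.
  rewrite (map_ext _ (fun j => laurent_coef H (j + 2) * x ^ j)).
  2: { intros j. rewrite Cpow_real. unfold Cmul, CofR, Cre, Cim; cbn [fst snd]. ring. }
  set (g := fun j => laurent_coef H (j + 2) * x ^ j).
  induction N as [|N IH].
  - simpl. ring.
  - rewrite seq_S, map_app, fold_right_app, tech5, <- IH. cbn [map fold_right].
    generalize (map g (seq 0 (S N))). rewrite Nat.add_0_l, Rplus_0_r.
    intros l; induction l as [|a l IHl]; cbn [fold_right]; [ring | rewrite IHl; ring].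
Qed.

(** Restricting to the positive real axis turns both complex limits into real ones with the same
    value A. *)
Lemma hurwitz_real_expansion w H : is_hurwitz_seq w H ->
  exists r, 0 < r /\ forall x, 0 < x < r -> exists A : R,
    is_lim_seq (fun N => Cre (Csub (wp_partial w (x, 0) N) (Cinv (Cmul (x, 0) (x, 0))))) A
    /\ is_lim_seq (sum_f_R0 (fun j => laurent_coef H (j + 2) * x ^ j)) A.
Proof.
  intros (r & Hr & Hz). exists r. split; [exact Hr|]. intros x Hx.
  destruct (Hz (x, 0)) as (v & Hv & Hl).
  { unfold Cnorm, Cre, Cim; cbn [fst snd].
    replace (x * x + 0 * 0) with (x ^ 2) by ring. rewrite sqrt_pow2; lra. }
  set (p := Cinv (Cmul (x, 0) (x, 0))) in *.
  exists (Cre (Csub v p)). split.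
  - apply (is_lim_seq_minus' (fun N => Cre (wp_partial w (x, 0) N)) (fun _ => Cre p)).
    + apply Cseq_cv_Cre, Hv.
    + apply is_lim_seq_const.
  - eapply is_lim_seq_ext; [|exact (Cseq_cv_Cre _ _ Hl)].
    intros N. apply Cre_laurent_partial.
Qed.

(** For small x > 0 the value A differs by O(x ^ (J + 2)) both from the truncated Laurent series and
    from the polynomial of lattice sums, so [small_poly_zero] identifies their coefficients. *)
Lemma laurent_coef_eq w H (e : nat -> R) J : 0 < w -> is_hurwitz_seq w H ->
  (forall j, is_lim_seq (square_sum (j + 3)) (e j)) ->
  laurent_coef H (J + 3) = (INR J + 2) * (/ w) ^ (J + 3) * e J.
Proof.
  intros Hw HH He.
  destruct (hurwitz_real_expansion w H HH) as (r & Hr & HA).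
  set (c := fun j => laurent_coef H (j + 2)).
  destruct (HA (r / 2) ltac:(lra)) as (A0 & _ & HA0).
  destruct (convergent_terms_bounded _ _ HA0) as [B HB].
  set (rho := r / 2) in *. assert (Hrho : 0 < rho) by (unfold rho; lra).
  (* The lattice expansion has no constant term and [wp_coef w x j] carries x ^ (j + 1), hence the
     shift of index. *)
  set (d := fun i => match i with
                     | O => c O
                     | S j => c (S j) - (INR j + 2) * (/ w) ^ (j + 3) * e j
                     end).
  set (K1 := 300 * (2 * INR (S J) + 3) * (/ w) ^ (J + 4)).
  set (K2 := 2 * B * (/ rho) ^ (J + 2)).
  assert (Hd : d (S J) = 0).
  { apply (small_poly_zero (S J) d (K1 + K2) (Rmin (w / 2) (rho / 2)));
      [apply Rmin_glb_lt; lra | | lia].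
    intros x Hx.
    pose proof (Rmin_l (w / 2) (rho / 2)). pose proof (Rmin_r (w / 2) (rho / 2)).
    destruct (HA x ltac:(unfold rho in *; lra)) as (A & HAw & HAc).
    (* Here N tends to infinity with J fixed, since [wp_partial_taylor] is uniform in N. *)
    assert (HAy : Rabs (A - sum_f_R0 (fun j => wp_coef w x j * e j) J) <= K1 * x ^ (J + 2)).
    { apply (is_lim_seq_abs_diff_le _
        (fun N => sum_f_R0 (fun j => wp_coef w x j * square_sum (j + 3) N) J) _ _ _ 0 HAw).
      - clear -He. induction J as [|J IH]; cbn [sum_f_R0].
        + exact (is_lim_seq_scal_l _ (wp_coef w x 0) _ (He O)).
        + apply is_lim_seq_plus'; [exact IH|].
          exact (is_lim_seq_scal_l _ (wp_coef w x (S J)) _ (He (S J))).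
      - intros N _. apply wp_partial_taylor; lra. }
    assert (HAx : Rabs (A - sum_f_R0 (fun j => c j * x ^ j) (S J)) <= K2 * x ^ (J + 2)).
    { apply (is_lim_seq_abs_diff_le _
        (fun _ => sum_f_R0 (fun j => c j * x ^ j) (S J)) _ _ _ (S J) HAc).
      - apply is_lim_seq_const.
      - intros N HN. replace N with (S J + (N - S J))%nat by lia.
        eapply Rle_trans; [apply (power_series_tail c rho B x (S J)); auto; lra|].
        unfold K2, Rdiv. rewrite Rpow_mult_distr.
        replace (S (S J)) with (J + 2)%nat by lia. lra. }
    assert (Hs : sum_f_R0 (fun j => d j * x ^ j) (S J)
      = sum_f_R0 (fun j => c j * x ^ j) (S J) - sum_f_R0 (fun j => wp_coef w x j * e j) J).
    { rewrite !(decomp_sum _ (S J)) by lia. cbn [pred d].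
      unfold Rminus. rewrite Rplus_assoc. f_equal.
      transitivity (sum_f_R0 (fun i => c (S i) * x ^ S i) J
                    + sum_f_R0 (fun i => wp_coef w x i * e i * - 1) J).
      - rewrite <- sum_plus. apply sum_eq. intros i _. unfold wp_coef. ring.
      - f_equal. rewrite <- scal_sum. ring. }
    rewrite Hs. replace (S (S J)) with (J + 2)%nat by lia.
    set (X := sum_f_R0 _ (S J)) in *. set (Y := sum_f_R0 _ J) in *.
    replace (X - Y) with ((A - Y) + - (A - X)) by ring.
    eapply Rle_trans; [apply Rabs_triang|]. rewrite Rabs_Ropp. lra. }
  cbn [d] in Hd. unfold c in Hd. replace (S J + 2)%nat with (J + 3)%nat in Hd by lia.
  lra.
Qed.

(** * Limits of the square sums and the values of the Hurwitz numbers *)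

(** The factor 1 + (-1) ^ (k + 1) merges two cases: four equal sectors when the sign is 1, and a sum
    that the rotation makes 0 when it is -1. *)
Lemma square_sum_even_limit k : (1 <= k)%nat ->
  exists I : R, improper_int_0_inf (integrand (2 * k + 1)) I /\
    is_lim_seq (square_sum (2 * (k + 1)))
      ((1 + (-1) ^ (k + 1)) * (4 * I / INR (fact (2 * k + 1)))).
Proof.
  intros Hk.
  destruct (improper_integral_sector_sum (2 * k - 1) ltac:(lia)) as (I & HI & HL).
  replace (S (S (2 * k - 1))) with (2 * k + 1)%nat in * by lia.
  replace (S (2 * k + 1)) with (2 * (k + 1))%nat in * by lia.
  exists I. split; [exact HI|].
  assert (Hs : (-1) ^ (k + 1) = 1 \/ (-1) ^ (k + 1) = -1).
  { clear. induction (k + 1)%nat as [|n [IH|IH]]; [left; reflexivity| |];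
      simpl; rewrite IH; [right | left]; ring. }
  destruct Hs as [Hs|Hs].
  - rewrite Hs.
    apply is_lim_seq_ext with (fun N => 4 * sector_sum (2 * (k + 1)) N).
    { intros N. symmetry. apply square_sum_sector; [lia | exact Hs]. }
    replace ((1 + 1) * (4 * I / INR (fact (2 * k + 1))))
      with (4 * (2 * I / INR (fact (2 * k + 1)))) by (unfold Rdiv; ring).
    exact (is_lim_seq_scal_l _ 4 _ HL).
  - rewrite Hs. replace ((1 + -1) * _) with 0 by ring.
    apply is_lim_seq_ext with (fun _ => 0); [|apply is_lim_seq_const].
    intros N. pose proof (square_sum_rotation (k + 1) N) as H. rewrite Hs in H. lra.
Qed.

(** Odd exponents give 0, and even ones converge through the improper integrals. Writing the limit
    with [Lim_seq] provides one sequence of limits for all exponents, as [laurent_coef_eq]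
    expects. *)
Lemma square_sum_limit j : is_lim_seq (square_sum (j + 3)) (real (Lim_seq (square_sum (j + 3)))).
Proof.
  apply Lim_seq_correct'.
  destruct (Nat.Even_or_Odd j) as [[i Hi]|[i Hi]].
  - exists 0. apply is_lim_seq_ext with (fun _ => 0); [|apply is_lim_seq_const].
    intros N. symmetry. replace (j + 3)%nat with (2 * (i + 1) + 1)%nat by lia.
    apply square_sum_odd.
  - destruct (square_sum_even_limit (i + 1) ltac:(lia)) as (I & _ & HI).
    replace (j + 3)%nat with (2 * (i + 1 + 1))%nat by lia. eexists; exact HI.
Qed.

(** The integrand is at least 1, so twice the integral up to some b >= 1 / 2 is at least 1; taking b
    close enough to 1 puts w at distance less than 1 from it. *)
Lemma omega_tilde_pos w : is_omega_tilde w -> 0 < w.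
Proof.
  intros [Hint Hlim]. destruct (Hlim 1 ltac:(lra)) as (delta & Hd & Hw).
  set (b := Rmax (1 / 2) (1 - delta / 2)).
  assert (Hb : 1 / 2 <= b /\ 1 - delta < b < 1).
  { pose proof (Rmax_l (1 / 2) (1 - delta / 2)). pose proof (Rmax_r (1 / 2) (1 - delta / 2)).
    fold b in H, H0. assert (b < 1) by (apply Rmax_lub_lt; lra). lra. }
  destruct (Hint b ltac:(lra)) as [pr]. specialize (Hw b pr ltac:(lra)).
  rewrite <- RInt_Reals in Hw.
  assert (Hle : RInt (fun _ => 1) 0 b <= RInt (fun x => / sqrt (1 - x ^ 4)) 0 b).
  { apply RInt_le; [lra | apply ex_RInt_const | apply ex_RInt_Reals_1, pr |].
    intros x Hx. rewrite <- Rinv_1. apply Rinv_le_contravar.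
    - apply sqrt_lt_R0. destruct (pow_lt_1_compat x 4) as [_ H4]; [lra | lia | lra].
    - rewrite <- sqrt_1 at 2. apply sqrt_le_1_alt.
      assert (0 <= x ^ 4) by (apply pow_le; lra). lra. }
  rewrite RInt_const in Hle.
  change ((b - 0) * 1 <= RInt (fun x => / sqrt (1 - x ^ 4)) 0 b) in Hle.
  apply Rabs_lt_between in Hw. lra.
Qed.

Theorem theorem14 (w : R) (H : nat -> R) (k : nat) :
  is_omega_tilde w ->
  is_hurwitz_seq w H ->
  (1 <= k)%nat ->
  exists I : R,
    improper_int_0_inf (fun t => exp (- t) * f1_i t * t ^ (2 * k + 1)) I /\
    H (2 * k + 2)%nat =
      2 * INR (k + 1) / (4 ^ k * w ^ (2 * k + 2)) * (1 + (-1) ^ (k + 1)) * I.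
Proof.
  intros Hom HH Hk. pose proof (omega_tilde_pos w Hom) as Hw.
  destruct (square_sum_even_limit k Hk) as (I & HI & HL).
  exists I. split; [exact HI|].
  (* The choice J = 2 k - 1 gives J + 3 = 2 k + 2, both as lattice exponent and as index of the
     Hurwitz number. *)
  pose proof (laurent_coef_eq w H _ (2 * k - 1) Hw HH square_sum_limit) as HE.
  cbv beta in HE. replace (2 * k - 1 + 3)%nat with (2 * (k + 1))%nat in HE by lia.
  rewrite (is_lim_seq_unique _ _ HL) in HE. cbn [real] in HE.
  unfold laurent_coef in HE.
  replace (2 * (k + 1))%nat with (2 * k + 2)%nat in HE by lia.
  replace (2 * k + 2 - 2)%nat with (2 * k)%nat in HE by lia.
  replace (2 * k + 1)%nat with (S (2 * k)) in HE by lia.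
  change (fact (S (2 * k))) with (S (2 * k) * fact (2 * k))%nat in HE.
  assert (E1 : INR (2 * k - 1) + 2 = 2 * INR k + 1).
  { rewrite minus_INR, mult_INR by lia. simpl; ring. }
  assert (E2 : INR (2 * k + 2) = 2 * INR k + 2) by (rewrite plus_INR, mult_INR; simpl; ring).
  assert (E3 : INR (k + 1) = INR k + 1) by (rewrite plus_INR; simpl; ring).
  assert (E4 : 2 ^ (2 * k + 2) = 4 * 4 ^ k).
  { rewrite pow_add, pow_mult. replace (2 ^ 2) with 4 by ring. ring. }
  rewrite mult_INR, S_INR, mult_INR, E1, E2, E4, pow_inv in HE. rewrite E3.
  pose proof (INR_fact_neq_0 (2 * k)) as Hf. pose proof (pos_INR k) as Hk0.
  assert (H4 : 4 ^ k <> 0) by (apply pow_nonzero; lra).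
  assert (Hwp : w ^ (2 * k + 2) <> 0) by (apply pow_nonzero; lra).
  change (INR 2) with 2 in HE.
  set (f := INR (fact (2 * k))) in *. set (W := w ^ (2 * k + 2)) in *.
  set (h := H (2 * k + 2)%nat) in *. set (s := (-1) ^ (k + 1)) in *. set (q := 4 ^ k) in *.
  (* The Hurwitz number is recovered from its Laurent coefficient by inverting the factor 4 * 4 ^ k
     / ((2 k + 2) (2 k)!). *)
  replace h with ((4 * q * h / (2 * INR k + 2) / f) * ((2 * INR k + 2) * f / (4 * q)))
    by (field; repeat split; lra).
  rewrite HE. field. repeat split; lra.
Qed.
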